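(* Let $n\ge 1$, and let $J,K \subseteq S_n^B=\{t,s_1,\ldots,s_{n-1}\}$. Let $\lambda=(\lambda_1,\ldots,\lambda_p)$ be the signed composition of $n$ corresponding to $J$, and let $\eta_\lambda$ (respectively $\epsilon_\lambda$) be the character of the representation of $H_n^B$ induced from the trivial (respectively sign) representation of the parabolic subalgebra $H_J$. Let $w$ be a parabolic element of type $K$. Then $$\eta_\lambda(T_w)=\sum_a q^{e_K(a)+g_K(a)}(q-1)^{d_K(a)+f_K(a)}, \qquad \epsilon_\lambda(T_w)=\sum_a (-1)^{e_K(a)+g_K(a)}(q-1)^{d_K(a)+f_K(a)},$$ where both sums are over all integer sequences $a=a_1a_2\cdots a_n$ such that (1) $1\le |a_i|\le p$ for $i=1,\ldots,n$; (2) $\#\{i : |a_i|=k\}=|\lambda_k|$ for $k=1,\ldots,p$; (3) if $t\in J$, then $a_i\neq -1$ for all $i$; (4) if $s_i\in K$, then $a_i\ge a_{i+1}$ ($1\le i\le n-1$); (5) if $t\in K$, then either $a_1<0$, or $a_1=1$ and $t\in J$; and where $d_K(a)=\#\{i : s_i\in K,\ a_i>a_{i+1}\}$, $e_K(a)=\#\{i : s_i\in K,\ a_i=a_{i+1}\}$, $f_K(a)=1$ if $t\in K$ and $a_1<0$ and $f_K(a)=0$ otherwise, and $g_K(a)=1$ if $t\in K$ and $a_1>0$ and $g_K(a)=0$ otherwise.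
   Context: The Coxeter group $B_n$ is realized as the group of signed permutations of $\{\pm1,\ldots,\pm n\}$ (permutations $w$ with $w(-i)=-w(i)$), generated by $t$ (which sends $1\mapsto -1$, $-1\mapsto 1$ and fixes all other elements) and $s_i$, $1\le i\le n-1$ (which swaps $i\leftrightarrow i+1$ and $-i\leftrightarrow -(i+1)$). $H_n^B$ is its Hecke algebra over $\mathbb{C}[q^{1/2},q^{-1/2}]$: generated by $T_s$, $s\in S_n^B$, with $T_s^2=(q-1)T_s+q$ and the braid relations of $B_n$; $T_w=T_{s_{i_1}}\cdots T_{s_{i_\ell}}$ for any reduced expression of $w$. For $J\subseteq S_n^B$, $H_J$ is the subalgebra generated by $\{T_s : s\in J\}$. The trivial representation of $H_J$ sends $T_u\mapsto q^{\ell(u)}$ and the sign representation sends $T_u \mapsto (-1)^{\ell(u)}$. The signed composition of $n$ corresponding to $J$ is $\lambda=(\lambda_1,\ldots,\lambda_p)$ where $(|\lambda_1|,\ldots,|\lambda_p|)$ is the composition of $n$ obtained by placing $n$ dots in a row and a bar between dots $i$ and $i+1$ exactly when $s_i\notin J$ (the parts are the sizes of the resulting blocks), and $\lambda_1<0$ if $t\in J$, all other parts positive. An element $w$ is parabolic of type $K\subseteq S_n^B$ if $w$ is a product of the elements of $K$, each appearing once, in some order. The induced representation from an $H_J$-module $V$ is $H_n^B\otimes_{H_J}V$. *)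

(* Defs.v *)
From HB Require Import structures.
From mathcomp Require Import all_boot all_order all_algebra all_fingroup.
From mathcomp Require Import generic_quotient boolp reals complex.

Set Implicit Arguments.
Unset Strict Implicit.
Unset Printing Implicit Defensive.

Import Order.TTheory GRing.Theory Num.Theory.
Local Open Scope ring_scope.
Local Open Scope quotient_scope.

Section Laurent.
Variable F : fieldType.

Definition laurent_pred : {pred {fraction {poly F}}} :=
  fun x => `[< exists (p : {poly F}) (m : nat),
                 x = FracField.tofrac p / FracField.tofrac 'X^m >].

Let Xn0 m : FracField.tofrac ('X^m : {poly F}) != 0.
Proof. by rewrite tofrac_eq0 -size_poly_eq0 size_polyXn. Qed.

Lemma laurent_subring : subring_closed laurent_pred.
Proof.
split.
- apply/asboolP; exists 1, 0; rewrite expr0 tofrac1 divr1 //.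
- move=> _ _ /asboolP[p [m ->]] /asboolP[r [k ->]]; apply/asboolP.
  exists (p * 'X^k - r * 'X^m), (m + k)%N.
  by rewrite -mulNr addf_div ?Xn0 // exprD tofracD !tofracM tofracN tofracM mulNr.
- move=> _ _ /asboolP[p [m ->]] /asboolP[r [k ->]]; apply/asboolP.
  by exists (p * r), (m + k)%N; rewrite exprD !tofracM mulf_div.
Qed.

HB.instance Definition _ :=
  GRing.isSubringClosed.Build {fraction {poly F}} laurent_pred laurent_subring.

(* The ring F[v, v^-1], as the fractions whose denominator is a power of v. *)
Record laurent := Laurent {
  laurent_val :> {fraction {poly F}};
  _ : laurent_val \in laurent_pred
}.
HB.instance Definition _ := [isSub for laurent_val].
HB.instance Definition _ := [Choice of laurent by <:].
HB.instance Definition _ := [SubChoice_isSubComNzRing of laurent by <:].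

Lemma laurent_var_subproof : FracField.tofrac 'X \in laurent_pred.
Proof. by apply/asboolP; exists 'X, 0; rewrite expr0 tofrac1 divr1. Qed.

Definition laurent_var : laurent := Laurent laurent_var_subproof.

End Laurent.

Section SignedPermutations.
Variable n : nat.

(* The rank is n.+1, and the dots are numbered from 0.  The generators are
   [None], standing for t, and [Some i] with i < n, which exchanges the dots i
   and i.+1, i.e., the numbers i.+1 and i.+2. *)
Definition gen := option 'I_n.
HB.instance Definition _ := Finite.on gen.

Definition gen_t : gen := None.
Definition gen_s (i : 'I_n) : gen := Some i.

Definition left_dot (i : 'I_n) : 'I_n.+1 := widen_ord (leqnSn n) i.
Definition right_dot (i : 'I_n) : 'I_n.+1 := lift ord0 i.

(* (i, false) stands for the number i.+1, and (i, true) for its opposite. *)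
Definition spoint := ('I_n.+1 * bool)%type.

Lemma spoint_opp_inj : injective (fun x : spoint => (x.1, ~~ x.2)).
Proof. by move=> [i b] [j c] [-> /negb_inj ->]. Qed.

Definition spoint_opp : {perm spoint} := perm spoint_opp_inj.

Definition signed_perm : {group {perm spoint}} := 'C[spoint_opp]%G.

Definition gen_perm (g : gen) : {perm spoint} :=
  if g is Some i then
    (tperm (left_dot i, false) (right_dot i, false)
     * tperm (left_dot i, true) (right_dot i, true))%g
  else tperm (ord0, false) (ord0, true).

(* The product of {perm _} applies its left factor first.  Inversion is an
   isomorphism onto the group with the opposite product that fixes the
   generators, so the convention is immaterial. *)
Definition word_perm (r : seq gen) : {perm spoint} :=
  (\prod_(g <- r) gen_perm g)%g.

Definition reduced_expression (r : seq gen) (w : {perm spoint}) : Prop :=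
  word_perm r = w /\ forall r', word_perm r' = w -> (size r <= size r')%N.

Definition parabolic_element (K : {set gen}) (w : {perm spoint}) : Prop :=
  w \in signed_perm /\ exists r, perm_eq r (enum K) /\ w = word_perm r.

Lemma gen_perm_signed g : gen_perm g \in signed_perm.
Proof.
apply/cent1P/commgP/conjg_fixP; case: g => [i|] /=; last first.
  by rewrite tpermJ !permE tpermC.
rewrite conjMg !tpermJ !permE /=; apply/commgP/conjg_fixP.
by rewrite tpermJ !tpermD // xpair_eqE andbF.
Qed.

(* Nodes of the Coxeter diagram, in the order t, s_1, s_2, ... *)
Definition gen_rank (g : gen) : nat := if g is Some i then i.+1 else 0.

Definition coxeter_order (g h : gen) : nat :=
  let a := minn (gen_rank g) (gen_rank h) in
  let b := maxn (gen_rank g) (gen_rank h) in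
  if a == b then 1 else if a.+1 == b then (if a == 0 then 4 else 3) else 2.

(* The word g h g h ... of length m. *)
Definition alternating_word (m : nat) (g h : gen) : seq gen :=
  [seq if odd k then h else g | k <- iota 0 m].

End SignedPermutations.

Arguments gen_t {n}.

Section HeckeAlgebra.
Variables (A : comNzRingType) (q : A) (n : nat).

Definition hecke_rel (B : algType A) (T : gen n -> B) : Prop :=
  (forall g, T g ^+ 2 = (q - 1) *: T g + q%:A) /\
  (forall g h, let m := coxeter_order g h in
     \prod_(k <- alternating_word m g h) T k
     = \prod_(k <- alternating_word m h g) T k).

Inductive hterm : Type :=
  | HGen of gen n
  | HConst of A
  | HAdd of hterm & hterm
  | HMul of hterm & hterm.

HB.instance Definition _ := gen_eqMixin hterm.
HB.instance Definition _ := gen_choiceMixin hterm.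

Definition hword (r : seq (gen n)) : hterm :=
  foldr (fun g => HMul (HGen g)) (HConst 1) r.

(* The least congruence that makes the quotient an A-algebra and imposes the
   quadratic and braid relations. *)
Inductive hcong : hterm -> hterm -> Prop :=
  | hcong_refl x : hcong x x
  | hcong_sym x y : hcong x y -> hcong y x
  | hcong_trans y x z : hcong x y -> hcong y z -> hcong x z
  | hcong_add x x' y y' :
      hcong x x' -> hcong y y' -> hcong (HAdd x y) (HAdd x' y')
  | hcong_mul x x' y y' :
      hcong x x' -> hcong y y' -> hcong (HMul x y) (HMul x' y')
  | hcong_addA x y z : hcong (HAdd x (HAdd y z)) (HAdd (HAdd x y) z)
  | hcong_addC x y : hcong (HAdd x y) (HAdd y x)
  | hcong_add0 x : hcong (HAdd (HConst 0) x) x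
  | hcong_addN x : hcong (HAdd (HMul (HConst (-1)) x) x) (HConst 0)
  | hcong_mulA x y z : hcong (HMul x (HMul y z)) (HMul (HMul x y) z)
  | hcong_mul1 x : hcong (HMul (HConst 1) x) x
  | hcong_mulDl x y z : hcong (HMul (HAdd x y) z) (HAdd (HMul x z) (HMul y z))
  | hcong_mulDr x y z : hcong (HMul x (HAdd y z)) (HAdd (HMul x y) (HMul x z))
  | hcong_constD a b : hcong (HAdd (HConst a) (HConst b)) (HConst (a + b))
  | hcong_constM a b : hcong (HMul (HConst a) (HConst b)) (HConst (a * b))
  | hcong_constC a x : hcong (HMul (HConst a) x) (HMul x (HConst a))
  | hcong_quadratic g :
      hcong (HMul (HGen g) (HGen g))
            (HAdd (HMul (HConst (q - 1)) (HGen g)) (HConst q))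
  | hcong_braid g h :
      hcong (hword (alternating_word (coxeter_order g h) g h))
            (hword (alternating_word (coxeter_order g h) h g)).

Definition hcongb : rel hterm := fun x y => `[< hcong x y >].

Lemma hcongb_refl : reflexive hcongb.
Proof. by move=> x; apply/asboolP/hcong_refl. Qed.

Lemma hcongb_sym : symmetric hcongb.
Proof. by move=> x y; apply/asboolP/asboolP; apply: hcong_sym. Qed.

Lemma hcongb_trans : transitive hcongb.
Proof.
by move=> y x z /asboolP xy /asboolP yz; apply/asboolP; exact: hcong_trans xy yz.
Qed.

Canonical hcong_equiv := EquivRel hcongb hcongb_refl hcongb_sym hcongb_trans.

Definition hecke := {eq_quot hcong_equiv}.
HB.instance Definition _ := Choice.on hecke.

Definition hclass (x : hterm) : hecke := \pi_hecke x.

Lemma hclassP x y : hcong x y <-> hclass x = hclass y.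
Proof.
by split=> [xy|/eqmodP/asboolP//]; apply/eqmodP/asboolP.
Qed.

Lemma hcong_repr x : hcong (repr (hclass x)) x.
Proof. by apply/hclassP; rewrite /hclass reprK. Qed.

Lemma hclassW (P : hecke -> Prop) : (forall x, P (hclass x)) -> forall x, P x.
Proof. by move=> H x; rewrite -[x]reprK; apply: H. Qed.

Definition hadd (x y : hecke) : hecke := hclass (HAdd (repr x) (repr y)).
Definition hmul (x y : hecke) : hecke := hclass (HMul (repr x) (repr y)).
Definition hopp (x : hecke) : hecke := hclass (HMul (HConst (-1)) (repr x)).
Definition hscale (a : A) (x : hecke) : hecke :=
  hclass (HMul (HConst a) (repr x)).

Let haddE x y : hadd (hclass x) (hclass y) = hclass (HAdd x y).
Proof. by apply/hclassP/hcong_add; apply: hcong_repr. Qed.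
Let hmulE x y : hmul (hclass x) (hclass y) = hclass (HMul x y).
Proof. by apply/hclassP/hcong_mul; apply: hcong_repr. Qed.
Let hoppE x : hopp (hclass x) = hclass (HMul (HConst (-1)) x).
Proof. by apply/hclassP/hcong_mul/hcong_repr/hcong_refl. Qed.
Let hscaleE a x : hscale a (hclass x) = hclass (HMul (HConst a) x).
Proof. by apply/hclassP/hcong_mul/hcong_repr/hcong_refl. Qed.

Section Evaluation.
Variables (B : algType A) (T : gen n -> B).

Fixpoint heval (x : hterm) : B :=
  match x with
  | HGen g => T g
  | HConst a => a%:A
  | HAdd y z => heval y + heval z
  | HMul y z => heval y * heval z
  end.

Lemma heval_word r : heval (hword r) = \prod_(g <- r) T g.
Proof.
by elim: r => [|g r IHr]; rewrite ?big_nil ?big_cons /= ?scale1r ?IHr.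
Qed.

Hypothesis relT : hecke_rel T.

Lemma heval_cong x y : hcong x y -> heval x = heval y.
Proof.
case: relT => quadT braidT.
elim=> //= {x y}.
- by move=> y x z _ -> _ ->.
- by move=> x x' y y' _ -> _ ->.
- by move=> x x' y y' _ -> _ ->.
- by move=> x y z; rewrite addrA.
- by move=> x y; rewrite addrC.
- by move=> x; rewrite scale0r add0r.
- by move=> x; rewrite mulr_algl scaleN1r addNr scale0r.
- by move=> x y z; rewrite mulrA.
- by move=> x; rewrite scale1r mul1r.
- by move=> x y z; rewrite mulrDl.
- by move=> x y z; rewrite mulrDr.
- by move=> a b; rewrite scalerDl.
- by move=> a b; rewrite mulr_algl scalerA.
- by move=> a x; rewrite mulr_algl mulr_algr.
- by move=> g; rewrite mulr_algl -expr2 quadT.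
- by move=> g h; rewrite !heval_word braidT.
Qed.

End Evaluation.

Definition constant_rel (c : A) : Prop := c ^+ 2 = (q - 1) * c + q.

Lemma constant_hecke_rel c :
  constant_rel c -> hecke_rel (fun=> c : A^o).
Proof.
move=> hc; split=> [g|g h].
  by rewrite [LHS]hc; congr (_ + _); rewrite /GRing.scale /= mulr1.
by move=> m; rewrite !big_const_seq !count_predT !size_map.
Qed.

Lemma constant_rel_q : constant_rel q.
Proof. by rewrite /constant_rel mulrBl mul1r subrK. Qed.

Lemma constant_rel_N1 : constant_rel (-1).
Proof. by rewrite /constant_rel sqrrN expr1n mulrN1 opprB subrK. Qed.

Lemma haddA : associative hadd.
Proof.
elim/hclassW=> x; elim/hclassW=> y; elim/hclassW=> z.
by rewrite !haddE; apply/hclassP/hcong_addA.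
Qed.
Lemma haddC : commutative hadd.
Proof.
elim/hclassW=> x; elim/hclassW=> y.
by rewrite !haddE; apply/hclassP/hcong_addC.
Qed.
Lemma hadd0 : left_id (hclass (HConst 0)) hadd.
Proof. by elim/hclassW=> x; rewrite haddE; apply/hclassP/hcong_add0. Qed.
Lemma haddN : left_inverse (hclass (HConst 0)) hopp hadd.
Proof. by elim/hclassW=> x; rewrite hoppE haddE; apply/hclassP/hcong_addN. Qed.

HB.instance Definition _ := GRing.isZmodule.Build hecke haddA haddC hadd0 haddN.

Lemma hmulA : associative hmul.
Proof.
elim/hclassW=> x; elim/hclassW=> y; elim/hclassW=> z.
by rewrite !hmulE; apply/hclassP/hcong_mulA.
Qed.
Lemma hmul1l : left_id (hclass (HConst 1)) hmul.
Proof. by elim/hclassW=> x; rewrite hmulE; apply/hclassP/hcong_mul1. Qed.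
Lemma hmul1r : right_id (hclass (HConst 1)) hmul.
Proof.
elim/hclassW=> x; rewrite hmulE; apply/hclassP.
by apply: hcong_trans (hcong_mul1 x); apply/hcong_sym/hcong_constC.
Qed.
Lemma hmulDl : left_distributive hmul +%R.
Proof.
elim/hclassW=> x; elim/hclassW=> y; elim/hclassW=> z.
by rewrite /GRing.add /= !(haddE, hmulE); apply/hclassP/hcong_mulDl.
Qed.
Lemma hmulDr : right_distributive hmul +%R.
Proof.
elim/hclassW=> x; elim/hclassW=> y; elim/hclassW=> z.
by rewrite /GRing.add /= !(haddE, hmulE); apply/hclassP/hcong_mulDr.
Qed.
Lemma hecke_nonzero : hclass (HConst 1) != 0 :> hecke.
Proof.
apply/eqP=> /hclassP/(heval_cong (constant_hecke_rel constant_rel_q))/eqP.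
by rewrite /= scale1r scale0r oner_eq0.
Qed.

HB.instance Definition _ := GRing.Zmodule_isNzRing.Build hecke
  hmulA hmul1l hmul1r hmulDl hmulDr hecke_nonzero.

Lemma hscaleA a b x : hscale a (hscale b x) = hscale (a * b) x.
Proof.
elim/hclassW: x => x; rewrite !hscaleE; apply/hclassP.
apply: hcong_trans (hcong_mulA _ _ _) _.
by apply: hcong_mul (hcong_constM a b) (hcong_refl x).
Qed.
Lemma hscale1 : left_id 1 hscale.
Proof. by elim/hclassW=> x; rewrite hscaleE; apply/hclassP/hcong_mul1. Qed.
Lemma hscaleDr : right_distributive hscale +%R.
Proof.
move=> a; elim/hclassW=> x; elim/hclassW=> y.
by rewrite /GRing.add /= !(haddE, hscaleE); apply/hclassP/hcong_mulDr.
Qed.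
Lemma hscaleDl x : {morph hscale^~ x : a b / a + b}.
Proof.
move=> a b; elim/hclassW: x => x.
rewrite /GRing.add /= !(haddE, hscaleE); apply/hclassP.
apply: hcong_trans (hcong_mulDl _ _ _).
by apply: hcong_mul (hcong_sym (hcong_constD a b)) (hcong_refl x).
Qed.

HB.instance Definition _ := GRing.Zmodule_isLmodule.Build A hecke
  hscaleA hscale1 hscaleDr hscaleDl.

Lemma hscaleAl (a : A) (x y : hecke) : a *: (x * y) = (a *: x) * y.
Proof.
elim/hclassW: x => x; elim/hclassW: y => y.
rewrite /GRing.scale /GRing.mul /= !(hmulE, hscaleE).
by apply/hclassP/hcong_mulA.
Qed.

HB.instance Definition _ := GRing.Lmodule_isLalgebra.Build A hecke hscaleAl.

Lemma hscaleAr (a : A) (x y : hecke) : a *: (x * y) = x * (a *: y).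
Proof.
elim/hclassW: x => x; elim/hclassW: y => y.
rewrite /GRing.scale /GRing.mul /= !(hmulE, hscaleE); apply/hclassP.
apply: hcong_trans (hcong_mulA _ _ _) _.
apply: hcong_trans (hcong_mul (hcong_constC _ _) (hcong_refl _)) _.
exact/hcong_sym/hcong_mulA.
Qed.

HB.instance Definition _ := GRing.Lalgebra_isAlgebra.Build A hecke hscaleAr.

Definition hecke_gen (g : gen n) : hecke := hclass (HGen g).

(* [hecke_word r] is the basis element T_w when r is a reduced expression of
   w. *)
Definition hecke_word (r : seq (gen n)) : hecke := \prod_(g <- r) hecke_gen g.

Let hclassD x y : hclass (HAdd x y) = hclass x + hclass y.
Proof. by rewrite -haddE. Qed.
Let hclassM x y : hclass (HMul x y) = hclass x * hclass y.
Proof. by rewrite -hmulE. Qed.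
Let hclassC a : hclass (HConst a) = a%:A.
Proof.
rewrite /GRing.scale /= hscaleE; apply/hclassP; apply: hcong_sym.
by apply: hcong_trans (hcong_constM a 1) _; rewrite mulr1; apply: hcong_refl.
Qed.
Let hclass_word r : hclass (hword r) = hecke_word r.
Proof.
rewrite /hecke_word; elim: r => [|g r IHr]; first by rewrite big_nil.
by rewrite big_cons -IHr -hclassM.
Qed.

Lemma hecke_genP : hecke_rel hecke_gen.
Proof.
split=> [g|g h m].
  have -> : (q - 1) *: hecke_gen g = hclass (HMul (HConst (q - 1)) (HGen g)).
    by rewrite hclassM hclassC mulr_algl.
  rewrite -hclassC -hclassD expr2 -hclassM.
  exact/hclassP/hcong_quadratic.
rewrite -[LHS]/(hecke_word _) -[RHS]/(hecke_word _) -!hclass_word.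
exact/hclassP/hcong_braid.
Qed.

Definition hecke_lift (B : algType A) (T : gen n -> B) of hecke_rel T :=
  fun x : hecke => heval T (repr x).

Section Lift.
Variables (B : algType A) (T : gen n -> B) (relT : hecke_rel T).

Let liftE x : hecke_lift relT (hclass x) = heval T x.
Proof. exact/(heval_cong relT)/hcong_repr. Qed.

Lemma hecke_lift_linear : linear (hecke_lift relT).
Proof.
move=> a; elim/hclassW=> x; elim/hclassW=> y.
by rewrite -mulr_algl -hclassC -hclassM -hclassD !liftE /= mulr_algl.
Qed.
HB.instance Definition _ := GRing.isLinear.Build A hecke B *:%R
  (hecke_lift relT) hecke_lift_linear.

Lemma hecke_lift_monoid : monoid_morphism (hecke_lift relT).
Proof.
split; first by rewrite [LHS](liftE (HConst 1)) /= scale1r.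
elim/hclassW=> x; elim/hclassW=> y.
by rewrite -hclassM !liftE.
Qed.
HB.instance Definition _ := GRing.isMonoidMorphism.Build hecke B
  (hecke_lift relT) hecke_lift_monoid.

Lemma hecke_lift_gen g : hecke_lift relT (hecke_gen g) = T g.
Proof. exact: (liftE (HGen g)). Qed.

(* Together with [hecke_lift_gen], this is the universal property of the
   presentation. *)
Lemma hecke_lift_uniq (f : {lrmorphism hecke -> B}) :
  (forall g, f (hecke_gen g) = T g) -> f =1 hecke_lift relT.
Proof.
move=> fT; elim/hclassW=> x; rewrite liftE.
elim: x => [g|a|x IHx y IHy|x IHx y IHy] /=.
- exact: fT.
- by rewrite hclassC linearZ /= rmorph1.
- by rewrite hclassD rmorphD /= IHx IHy.
- by rewrite hclassM rmorphM /= IHx IHy.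
Qed.

End Lift.

Section Parabolic.
Variable J : {set gen n}.

Inductive in_parabolic : hecke -> Prop :=
  | in_parabolic_gen g : g \in J -> in_parabolic (hecke_gen g)
  | in_parabolic1 : in_parabolic 1
  | in_parabolicZ a x : in_parabolic x -> in_parabolic (a *: x)
  | in_parabolicD x y : in_parabolic x -> in_parabolic y -> in_parabolic (x + y)
  | in_parabolicM x y :
      in_parabolic x -> in_parabolic y -> in_parabolic (x * y).

Definition parabolic_pred : {pred hecke} := fun x => `[< in_parabolic x >].

Lemma parabolic_subalg : subalg_closed parabolic_pred.
Proof.
split.
- exact/asboolP/in_parabolic1.
- move=> a x y /asboolP Jx /asboolP Jy; apply/asboolP.
  by apply: in_parabolicD => //; apply: in_parabolicZ.
- by move=> x y /asboolP Jx /asboolP Jy; apply/asboolP/in_parabolicM.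
Qed.

HB.instance Definition _ :=
  GRing.isSubalgClosed.Build A hecke parabolic_pred parabolic_subalg.

Record hecke_parabolic := HeckeParabolic {
  parabolic_val :> hecke;
  _ : parabolic_val \in parabolic_pred
}.
HB.instance Definition _ := [isSub for parabolic_val].
HB.instance Definition _ := [Choice of hecke_parabolic by <:].
HB.instance Definition _ := [SubChoice_isSubAlgebra of hecke_parabolic by <:].

(* The representations of the parabolic subalgebra on A that send each of its
   generators to q, respectively -1; [trivial_repE] and [sign_repE] give their
   values on the elements T_u. *)
Definition trivial_rep : hecke_parabolic -> A^o :=
  hecke_lift (constant_hecke_rel constant_rel_q) \o (\val : hecke_parabolic -> hecke).
HB.instance Definition _ := GRing.RMorphism.on trivial_rep.
HB.instance Definition _ := GRing.Linear.on trivial_rep.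

Definition sign_rep : hecke_parabolic -> A^o :=
  hecke_lift (constant_hecke_rel constant_rel_N1) \o (\val : hecke_parabolic -> hecke).
HB.instance Definition _ := GRing.RMorphism.on sign_rep.
HB.instance Definition _ := GRing.Linear.on sign_rep.

Lemma trivial_repE u r (x : hecke_parabolic) :
  reduced_expression r u -> \val x = hecke_word r ->
  trivial_rep x = q ^+ size r.
Proof.
move=> _ xr; rewrite /trivial_rep /= [parabolic_val x]xr rmorph_prod /=.
under eq_bigr do rewrite hecke_lift_gen.
by rewrite big_const_seq count_predT iter_mulr_1.
Qed.

Lemma sign_repE u r (x : hecke_parabolic) :
  reduced_expression r u -> \val x = hecke_word r ->
  sign_rep x = (-1) ^+ size r.
Proof.
move=> _ xr; rewrite /sign_rep /= [parabolic_val x]xr rmorph_prod /=.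
under eq_bigr do rewrite hecke_lift_gen.
by rewrite big_const_seq count_predT iter_mulr_1.
Qed.

End Parabolic.

End HeckeAlgebra.

Arguments trivial_rep {A} q {n} J _.
Arguments sign_rep {A} q {n} J _.

(* B, seen as a left S-module through a ring morphism chi : S -> B. *)
Definition char_module (S B : nzRingType) (chi : {rmorphism S -> B}) : Type := B.

Section CharModule.
Variables (S B : nzRingType) (chi : {rmorphism S -> B}).
Local Notation V := (char_module chi).
HB.instance Definition _ := GRing.Zmodule.copy V B.
Definition char_scale (s : S) (v : V) : V := (chi s : B) * (v : B).
Lemma char_scaleA s t v : char_scale s (char_scale t v) = char_scale (s * t) v.
Proof. by rewrite /char_scale rmorphM mulrA. Qed.
Lemma char_scale1 : left_id 1 char_scale.
Proof. by move=> v; rewrite /char_scale rmorph1 mul1r. Qed.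
Lemma char_scaleDr : right_distributive char_scale +%R.
Proof. by move=> s u v; rewrite /char_scale [LHS]mulrDr. Qed.
Lemma char_scaleDl v : {morph char_scale^~ v : s t / s + t}.
Proof. by move=> s t; rewrite /char_scale rmorphD [LHS]mulrDl. Qed.
HB.instance Definition _ := GRing.Zmodule_isLmodule.Build S V
  char_scaleA char_scale1 char_scaleDr char_scaleDl.
End CharModule.

(* The tensor product of H and V over S, for a ring morphism iota : S -> H and a
   left S-module V, with its left H-module structure. *)
Section Induced.
Variables (S H : nzRingType) (iota : {rmorphism S -> H}) (V : lmodType S).

Inductive tterm : Type :=
  | TPure of H & V
  | TZero
  | TOpp of tterm
  | TAdd of tterm & tterm.

HB.instance Definition _ := gen_eqMixin tterm.
HB.instance Definition _ := gen_choiceMixin tterm.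

(* The least congruence that makes the quotient an abelian group in which
   [TPure] is biadditive and S-balanced. *)
Inductive tcong : tterm -> tterm -> Prop :=
  | tcong_refl x : tcong x x
  | tcong_sym x y : tcong x y -> tcong y x
  | tcong_trans y x z : tcong x y -> tcong y z -> tcong x z
  | tcong_opp x x' : tcong x x' -> tcong (TOpp x) (TOpp x')
  | tcong_add x x' y y' :
      tcong x x' -> tcong y y' -> tcong (TAdd x y) (TAdd x' y')
  | tcong_addA x y z : tcong (TAdd x (TAdd y z)) (TAdd (TAdd x y) z)
  | tcong_addC x y : tcong (TAdd x y) (TAdd y x)
  | tcong_add0 x : tcong (TAdd TZero x) x
  | tcong_addN x : tcong (TAdd (TOpp x) x) TZero
  | tcong_pureDl h k v :
      tcong (TPure (h + k) v) (TAdd (TPure h v) (TPure k v))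
  | tcong_pureDr h u v :
      tcong (TPure h (u + v)) (TAdd (TPure h u) (TPure h v))
  | tcong_balanced h s v : tcong (TPure (h * iota s) v) (TPure h (s *: v)).

Definition tcongb : rel tterm := fun x y => `[< tcong x y >].

Lemma tcongb_refl : reflexive tcongb.
Proof. by move=> x; apply/asboolP/tcong_refl. Qed.

Lemma tcongb_sym : symmetric tcongb.
Proof. by move=> x y; apply/asboolP/asboolP; apply: tcong_sym. Qed.

Lemma tcongb_trans : transitive tcongb.
Proof.
by move=> y x z /asboolP xy /asboolP yz; apply/asboolP; exact: tcong_trans xy yz.
Qed.

Canonical tcong_equiv := EquivRel tcongb tcongb_refl tcongb_sym tcongb_trans.

Definition induced := {eq_quot tcong_equiv}.
HB.instance Definition _ := Choice.on induced.

Definition tclass (x : tterm) : induced := \pi_induced x.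

Lemma tclassP x y : tcong x y <-> tclass x = tclass y.
Proof.
by split=> [xy|/eqmodP/asboolP//]; apply/eqmodP/asboolP.
Qed.

Lemma tcong_repr x : tcong (repr (tclass x)) x.
Proof. by apply/tclassP; rewrite /tclass reprK. Qed.

Lemma tclassW (P : induced -> Prop) :
  (forall x, P (tclass x)) -> forall x, P x.
Proof. by move=> P_ x; rewrite -[x]reprK; apply: P_. Qed.

Fixpoint tact (h : H) (x : tterm) : tterm :=
  match x with
  | TPure k v => TPure (h * k) v
  | TZero => TZero
  | TOpp y => TOpp (tact h y)
  | TAdd y z => TAdd (tact h y) (tact h z)
  end.

Lemma tact_cong h x y : tcong x y -> tcong (tact h x) (tact h y).
Proof.
elim=> /= {x y}.
- by move=> x; apply: tcong_refl.
- by move=> x y _; apply: tcong_sym.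
- by move=> x y z _ xy _; apply: tcong_trans.
- by move=> x x' _; apply: tcong_opp.
- by move=> x x' y y' _ xx' _; apply: tcong_add.
- by move=> x y z; apply: tcong_addA.
- by move=> x y; apply: tcong_addC.
- by move=> x; apply: tcong_add0.
- by move=> x; apply: tcong_addN.
- by move=> k l v; rewrite mulrDr; apply: tcong_pureDl.
- by move=> k u v; apply: tcong_pureDr.
- by move=> k s v; rewrite mulrA; apply: tcong_balanced.
Qed.

Definition tadd (x y : induced) : induced := tclass (TAdd (repr x) (repr y)).
Definition topp (x : induced) : induced := tclass (TOpp (repr x)).
Definition tscale (h : H) (x : induced) : induced := tclass (tact h (repr x)).

Let taddE x y : tadd (tclass x) (tclass y) = tclass (TAdd x y).
Proof. by apply/tclassP/tcong_add; apply: tcong_repr. Qed.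
Let toppE x : topp (tclass x) = tclass (TOpp x).
Proof. by apply/tclassP/tcong_opp; apply: tcong_repr. Qed.
Let tscaleE h x : tscale h (tclass x) = tclass (tact h x).
Proof. by apply/tclassP/tact_cong; apply: tcong_repr. Qed.

Lemma taddA : associative tadd.
Proof.
elim/tclassW=> x; elim/tclassW=> y; elim/tclassW=> z.
by rewrite !taddE; apply/tclassP/tcong_addA.
Qed.
Lemma taddC : commutative tadd.
Proof.
elim/tclassW=> x; elim/tclassW=> y.
by rewrite !taddE; apply/tclassP/tcong_addC.
Qed.
Lemma tadd0 : left_id (tclass TZero) tadd.
Proof. by elim/tclassW=> x; rewrite taddE; apply/tclassP/tcong_add0. Qed.
Lemma taddN : left_inverse (tclass TZero) topp tadd.
Proof. by elim/tclassW=> x; rewrite toppE taddE; apply/tclassP/tcong_addN. Qed.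

HB.instance Definition _ :=
  GRing.isZmodule.Build induced taddA taddC tadd0 taddN.

Let tclassD x y : tclass (TAdd x y) = tclass x + tclass y.
Proof. by rewrite -taddE. Qed.
Let tclassN x : tclass (TOpp x) = - tclass x.
Proof. by rewrite -toppE. Qed.

Lemma tscaleA h k x : tscale h (tscale k x) = tscale (h * k) x.
Proof.
elim/tclassW: x => x; rewrite !tscaleE; congr tclass.
by elim: x => //= [l v|x ->|x -> y ->] //; rewrite mulrA.
Qed.
Lemma tscale1 : left_id 1 tscale.
Proof.
elim/tclassW=> x; rewrite tscaleE; congr tclass.
by elim: x => //= [l v|x ->|x -> y ->] //; rewrite mul1r.
Qed.
Lemma tscaleDr : right_distributive tscale +%R.
Proof.
move=> h; elim/tclassW=> x; elim/tclassW=> y.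
by rewrite -tclassD !tscaleE /= tclassD.
Qed.
Lemma tscaleDl x : {morph tscale^~ x : h k / h + k}.
Proof.
move=> h k; elim/tclassW: x => x; rewrite !tscaleE.
elim: x => [l v||x IHx|x IHx y IHy] /=.
- by rewrite mulrDl -tclassD; apply/tclassP/tcong_pureDl.
- by rewrite [RHS]addr0.
- by rewrite !tclassN IHx opprD.
- by rewrite !tclassD IHx IHy addrACA.
Qed.

HB.instance Definition _ := GRing.Zmodule_isLmodule.Build H induced
  tscaleA tscale1 tscaleDr tscaleDl.

Definition tensor (h : H) (v : V) : induced := tclass (TPure h v).

Lemma tensorDl h k v : tensor (h + k) v = tensor h v + tensor k v.
Proof. by rewrite -tclassD; apply/tclassP/tcong_pureDl. Qed.
Lemma tensorDr h u v : tensor h (u + v) = tensor h u + tensor h v.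
Proof. by rewrite -tclassD; apply/tclassP/tcong_pureDr. Qed.
Lemma tensor_balanced h s v : tensor (h * iota s) v = tensor h (s *: v).
Proof. exact/tclassP/tcong_balanced. Qed.
Lemma tensorZ h k v : h *: tensor k v = tensor (h * k) v.
Proof. exact: tscaleE. Qed.

End Induced.

Definition induced_rep (A : comNzRingType) (q : A) (n : nat) (J : {set gen n})
    (chi : {lrmorphism hecke_parabolic q J -> A^o}) : lmodType (hecke q n) :=
  induced (\val : {rmorphism hecke_parabolic q J -> hecke q n})
          (char_module chi).

Section Character.
Variables (A : comNzRingType) (H : algType A) (M : lmodType H).

Definition is_basis (m : nat) (e : 'I_m -> M) : Prop :=
  forall x, exists! c : 'rV[A]_m, x = \sum_i (c 0 i)%:A *: e i.

(* M is free of finite rank over A, and the trace of h on M is c. *)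
Definition is_character_value (h : H) (c : A) : Prop :=
  exists (m : nat) (e : 'I_m -> M) (B : 'M[A]_m),
    [/\ is_basis e,
        forall j, h *: e j = \sum_i (B i j)%:A *: e i
      & \tr B = c].

Let coord_trans m m' (e : 'I_m -> M) (e' : 'I_m' -> M) (P : 'M[A]_(m, m')) c :
  (forall j, e' j = \sum_i (P i j)%:A *: e i) ->
  \sum_j (c j)%:A *: e' j = \sum_i (\sum_j P i j * c j)%:A *: e i.
Proof.
move=> eP; under eq_bigr do rewrite eP scaler_sumr.
rewrite exchange_big /=; apply: eq_bigr => i _.
rewrite [(\sum_j _)%:A]scaler_suml scaler_suml; apply: eq_bigr => j _.
by rewrite scalerA mulr_algl scalerA mulrC.
Qed.

Let coord_uniq m m' (e : 'I_m -> M) (P P' : 'M[A]_(m, m')) : is_basis e ->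
  (forall j, \sum_i (P i j)%:A *: e i = \sum_i (P' i j)%:A *: e i) -> P = P'.
Proof.
move=> be PP'; apply/matrixP=> i j.
have [c [_ cU]] := be (\sum_i (P i j)%:A *: e i).
have row_of (Q : 'M[A]_(m, m')) :
    \sum_i (P i j)%:A *: e i = \sum_i (Q i j)%:A *: e i ->
    c = \row_i Q i j.
  by move=> PQ; apply: cU; rewrite PQ; apply: eq_bigr => k _; rewrite mxE.
have := row_of P' (PP' j); rewrite (row_of P erefl) => /rowP/(_ i).
by rewrite !mxE.
Qed.

Let change_basis m m' (e : 'I_m -> M) (e' : 'I_m' -> M) : is_basis e ->
  exists P : 'M[A]_(m, m'), forall j, e' j = \sum_i (P i j)%:A *: e i.
Proof.
move=> be.
have ex j : exists c : 'rV[A]_m, e' j == \sum_i (c 0 i)%:A *: e i.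
  by have [c [/eqP ec _]] := be (e' j); exists c.
exists (\matrix_(i, j) xchoose (ex j) 0 i) => j.
rewrite [LHS](eqP (xchooseP (ex j))).
by apply: eq_bigr => i _; rewrite mxE.
Qed.

Lemma is_character_value_uniq h c c' :
  is_character_value h c -> is_character_value h c' -> c = c'.
Proof.
move=> [m [e [B [be hB <-]]]] [m' [e' [B' [be' hB' <-]]]].
have [P eP] := change_basis e' be; have [Q eQ] := change_basis e be'.
have PQ : P *m Q = 1%:M.
  apply: (coord_uniq be) => j.
  rewrite (eq_bigr (fun i => (\sum_k P i k * Q k j)%:A *: e i)); last first.
    by move=> i _; rewrite mxE.
  rewrite -(coord_trans _ eP) -eQ (bigD1 j) //= mxE eqxx scale1r scale1r.
  rewrite big1 ?addr0 // => i /negbTE ij.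
  by rewrite mxE ij /= scale0r scale0r.
suff -> : B = P *m (B' *m Q).
  rewrite mxtrace_mulC -mulmxA.
  have -> : Q *m P = 1%:M.
    apply: (coord_uniq be') => j.
    rewrite (eq_bigr (fun i => (\sum_k Q i k * P k j)%:A *: e' i)); last first.
      by move=> i _; rewrite mxE.
    rewrite -(coord_trans _ eQ) -eP (bigD1 j) //= mxE eqxx scale1r scale1r.
    rewrite big1 ?addr0 // => i /negbTE ij.
    by rewrite mxE ij /= scale0r scale0r.
  by rewrite mulmx1.
apply: (coord_uniq be) => j; rewrite -hB eQ scaler_sumr.
have -> : \sum_i h *: ((Q i j)%:A *: e' i)
          = \sum_i (Q i j)%:A *: \sum_k (B' k i)%:A *: e' k.
  apply: eq_bigr => i _.
  by rewrite -hB' !scalerA mulr_algl mulr_algr.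
under eq_bigr => i _ do rewrite scaler_sumr.
rewrite exchange_big /=.
rewrite (eq_bigr (fun k => ((B' *m Q) k j)%:A *: e' k)); last first.
  move=> k _; rewrite mxE [(\sum_i _)%:A]scaler_suml scaler_suml.
  by apply: eq_bigr => i _; rewrite scalerA mulr_algl scalerA mulrC.
rewrite (coord_trans _ eP); apply: eq_bigr => i _.
by rewrite mxE.
Qed.

End Character.

Section Sequences.
Variable n : nat.
Implicit Types (J K : {set gen n}) (lam : seq int) (a : 'I_n.+1 -> int).

(* The number of dots to the left of each bar, in increasing order. *)
Definition bars J : seq nat :=
  [seq i.+1 | i : 'I_n <- enum 'I_n & gen_s i \notin J].

Definition block_sizes J : seq nat :=
  pairmap (fun x y => y - x)%N 0%N (rcons (bars J) n.+1).

Definition signed_composition J : seq int :=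
  if block_sizes J is m :: s then
    (if gen_t \in J then - m%:Z else m%:Z) :: [seq k%:Z | k <- s]
  else [::].

Definition admissible J K lam a : bool :=
  [&& [forall i, (1 <= `|a i|) && (`|a i| <= (size lam)%:Z)],
      [forall k : 'I_(size lam),
         #|[set i | `|a i| == k.+1%:Z]|%:Z == `|lam`_k| ],
      (gen_t \in J) ==> [forall i, a i != -1],
      [forall i : 'I_n,
         (gen_s i \in K) ==> (a (right_dot i) <= a (left_dot i))]
    & (gen_t \in K) ==>
         ((a ord0 < 0) || (a ord0 == 1) && (gen_t \in J))].

Definition stat_d K a : nat :=
  #|[set i : 'I_n | (gen_s i \in K) && (a (right_dot i) < a (left_dot i))]|.
Definition stat_e K a : nat :=
  #|[set i : 'I_n | (gen_s i \in K) && (a (left_dot i) == a (right_dot i))]|.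
Definition stat_f K a : nat := (gen_t \in K) && (a ord0 < 0).
Definition stat_g K a : nat := (gen_t \in K) && (0 < a ord0).

End Sequences.

Definition int_of_ord (p : nat) (x : 'I_p.*2.+1) : int := (x : nat)%:Z - p%:Z.

(* The integer sequences of length m with all entries between - p and p. *)
Definition int_seqs (m p : nat) : seq ('I_m -> int) :=
  [seq (fun i => int_of_ord (a i)) | a : {ffun 'I_m -> 'I_p.*2.+1}].

(* Main.v *)
(* The module induced from a one-dimensional representation of H_J with value c
   on the generators has a basis indexed by the sequences a satisfying (1)-(3),
   i.e., by the cosets of W_J.  A generator multiplies the basis vector of a by c
   if it fixes a, and otherwise acts by the usual formulas, according to whether
   it lengthens or shortens a.  These formulas define an H-module of functions on
   sequences, by a check of the braid relations on the letters that are moved;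
   mapping the induced module to it gives the linear independence.  For spanning,
   the basis vector of a is obtained from 1 (x) 1 along any chain of descents from
   a to the minimal sequence; it does not depend on the chain because two descents
   g, h of a can be completed to the two descending alternating words in g and h.

   A reduced word of a parabolic element of type K uses every element of K exactly
   once.  Applying each generator at most once, one cannot leave a sequence and
   return to it: a sign change would be irreversible, and without sign changes
   only s_i changes the sum of the first i letters.  Hence the diagonal entry of
   T_w at a is the product over K of the diagonal entries of the generators. *)
Require Import Defs.
From HB Require Import structures.
From mathcomp Require Import all_boot all_order all_algebra all_fingroup.
From mathcomp Require Import generic_quotient boolp functions reals complex.
From mathcomp Require Import zify ring.

Set Implicit Arguments.
Unset Strict Implicit.
Unset Printing Implicit Defensive.

Import Order.TTheory GRing.Theory Num.Theory.
Local Open Scope ring_scope.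

(** A property symmetric in two generators needs one check for each kind of bond: equal generators,
    commuting ones, neighbouring swaps, and the double bond at [t]. *)
Lemma coxeter_ind n (P : nat -> gen n -> gen n -> Prop) :
  (forall m g h, P m g h -> P m h g) ->
  (forall g, P 1 g g) ->
  (forall g h, ((gen_rank g).+1 < gen_rank h)%N -> P 2 g h) ->
  (forall i j : 'I_n, j = i.+1 :> nat -> P 3 (Some i) (Some j)) ->
  (forall i : 'I_n, i = 0 :> nat -> P 4 None (Some i)) ->
  forall g h, P (coxeter_order g h) g h.
Proof.
move=> Psym P1 P2 P3 P4 g h.
wlog gh : g h / (gen_rank g <= gen_rank h)%N.
  move=> H; case: (leqP (gen_rank g) (gen_rank h)) => [/H //|/ltnW/H].
  by rewrite /coxeter_order minnC maxnC; apply: Psym.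
rewrite /coxeter_order (minn_idPl gh) (maxn_idPr gh).
have [eqr|ner] := eqVneq (gen_rank g) (gen_rank h).
  suff -> : g = h by apply: P1.
  by case: g h eqr {gh} => [i|] [j|] //= [] /val_inj ->.
have [eqr|ner'] := eqVneq (gen_rank g).+1 (gen_rank h); last first.
  by apply: P2; rewrite ltn_neqAle ner' ltn_neqAle ner.
case: g h eqr {gh ner} => [i|] [j|] //= [] ij; first exact: P3.
by apply: P4.
Qed.

(** * Generators acting on sequences of letters, and descents *)

Section Arrangements.
Variables (n theta : nat).

Local Notation T := {ffun 'I_n.+1 -> int}.
Implicit Types (b : T) (g h : gen n) (x y z : int).

(* The letters of absolute value at most [theta] have lost their sign; [theta]
   will be 1 if t belongs to J and 0 otherwise. *)
Definition flip x : int := if `|x| <= theta%:Z then x else - x.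

Lemma flipK : involutive flip.
Proof.
move=> x; rewrite /flip; case xF: (`|x| <= theta%:Z); first by rewrite xF.
by rewrite normrN xF opprK.
Qed.

Lemma flip_gt x : (x < flip x) = (x < - theta%:Z).
Proof. by rewrite /flip; case: ifP; lia. Qed.

Lemma flip_neg x : x < - theta%:Z -> flip x = - x.
Proof. by rewrite /flip; case: ifP; lia. Qed.

Lemma flip_fixed x : (flip x == x) = (`|x| <= theta%:Z).
Proof. by rewrite /flip; case: ifP; lia. Qed.

(* The generator g fixes b if both keys agree, and shortens it if
   [rkey g b < lkey g b]. *)
Definition lkey g b : int :=
  if g is Some i then b (left_dot i) else flip (b ord0).
Definition rkey g b : int :=
  if g is Some i then b (right_dot i) else b ord0.

Definition gen_act g b : T :=
  if g is Some i then [ffun k => b (tperm (left_dot i) (right_dot i) k)]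
  else [ffun k => if k == ord0 then flip (b k) else b k].

Lemma dots_neq (i : 'I_n) : left_dot i != right_dot i.
Proof. by rewrite -val_eqE /= /bump /=; lia. Qed.

Lemma lkey_act g b : lkey g (gen_act g b) = rkey g b.
Proof. by case: g => [i|]; rewrite /= ffunE ?tpermL ?eqxx ?flipK. Qed.

Lemma rkey_act g b : rkey g (gen_act g b) = lkey g b.
Proof. by case: g => [i|]; rewrite /= ffunE ?tpermR ?eqxx. Qed.

Lemma gen_actK g : involutive (gen_act g).
Proof.
move=> b; apply/ffunP => k; case: g => [i|]; rewrite !ffunE ?tpermK //.
by case: eqP; rewrite ?flipK.
Qed.

Lemma gen_act_fix g b : lkey g b = rkey g b -> gen_act g b = b.
Proof.
case: g => [i|] /= e; apply/ffunP => k; rewrite !ffunE.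
  by case: tpermP => // ->.
by case: eqP => // ->.
Qed.

Lemma far_act g h b : ((gen_rank g).+1 < gen_rank h)%N ->
  [/\ gen_act g (gen_act h b) = gen_act h (gen_act g b),
      lkey g (gen_act h b) = lkey g b, rkey g (gen_act h b) = rkey g b,
      lkey h (gen_act g b) = lkey h b & rkey h (gen_act g b) = rkey h b].
Proof.
case: h => [j|]; last by case: g.
case: g => [i|] /= far; split; rewrite ?ffunE ?tpermD //;
  rewrite -?val_eqE /= ?leq0n /bump /=; try by [lia | case: eqP => //; lia].
- have D k : k = left_dot i \/ k = right_dot i ->
      tperm (left_dot j) (right_dot j) k = k.
    by move=> kE; rewrite tpermD // -val_eqE /= /bump;
      case: kE => -> /=; rewrite /bump; lia.
  apply/ffunP => k; rewrite !ffunE; congr (b _).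
  case: (tpermP (left_dot i)) => [->|->|/eqP k1 /eqP k2];
    rewrite ?(D _ (or_introl erefl)) ?(D _ (or_intror erefl)) ?tpermL ?tpermR //.
  by rewrite [RHS]tpermD //; case: tpermP => [_|_|_ _];
    rewrite 1?eq_sym // -val_eqE /= /bump; lia.
- apply/ffunP => k; rewrite !ffunE /=.
  have [->|k0] := eqVneq k ord0.
    by rewrite tpermD ?eqxx // -val_eqE /= /bump; lia.
  suff /negbTE -> : tperm (left_dot j) (right_dot j) k != ord0 by [].
  by case: tpermP => // _; rewrite -val_eqE /= /bump; lia.
Qed.

(** Only three letters are touched, so [U] isolates them as free arguments; a check of the braid
    relation becomes a computation with triples. *)
Lemma adjacent_act (i j : 'I_n) b : j = i.+1 :> nat ->
  exists U x y z, [/\ b = U x y z,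
    [/\ forall x y z, lkey (Some i) (U x y z) = x,
        forall x y z, rkey (Some i) (U x y z) = y &
        forall x y z, gen_act (Some i) (U x y z) = U y x z] &
    [/\ forall x y z, lkey (Some j) (U x y z) = y,
        forall x y z, rkey (Some j) (U x y z) = z &
        forall x y z, gen_act (Some j) (U x y z) = U x z y]].
Proof.
move=> ij; pose l := left_dot i; pose r := right_dot i; pose s := right_dot j.
have lj : left_dot j = r by apply/val_inj.
have lr : l == r = false by apply/negbTE/dots_neq.
have rs : r == s = false by rewrite -lj; apply/negbTE/dots_neq.
have ls : l == s = false by rewrite -val_eqE /= /bump /=; lia.
pose U x y z : T := [ffun k => if k == l then x else if k == r then y
                               else if k == s then z else b k].
exists U, (b l), (b r), (b s); split.
  by apply/ffunP => k; rewrite ffunE; do 3?case: eqP => [->//|_].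
all: split=> x y z; rewrite /= ?lj ?ffunE -/l -/r -/s ?eqxx ?[r == l]eq_sym
  ?[s == l]eq_sym ?[s == r]eq_sym ?lr ?ls ?rs //;
  apply/ffunP => k; rewrite !ffunE /=; case: tpermP => [->|->|/eqP/negbTE k1 /eqP/negbTE k2];
  by rewrite ?eqxx ?[r == l]eq_sym ?[s == l]eq_sym ?[s == r]eq_sym ?lr ?ls ?rs
             -/l -/r -/s ?k1 ?k2.
Qed.

Lemma sign_act (i : 'I_n) b : i = 0 :> nat ->
  exists U x y, [/\ b = U x y,
    [/\ forall x y, lkey None (U x y) = flip x,
        forall x y, rkey None (U x y) = x &
        forall x y, gen_act None (U x y) = U (flip x) y] &
    [/\ forall x y, lkey (Some i) (U x y) = x,
        forall x y, rkey (Some i) (U x y) = y &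
        forall x y, gen_act (Some i) (U x y) = U y x]].
Proof.
move=> i0; pose r := right_dot i.
have li : left_dot i = ord0 by apply/val_inj.
have lr : ord0 == r = false by rewrite -li; apply/negbTE/dots_neq.
pose U x y : T := [ffun k => if k == ord0 then x else if k == r then y else b k].
exists U, (b ord0), (b r); split.
  by apply/ffunP => k; rewrite ffunE; do 2?case: eqP => [->//|_].
all: split=> x y; rewrite /= ?li ?ffunE -/r ?eqxx ?[r == ord0]eq_sym ?lr //;
  apply/ffunP => k; rewrite !ffunE /=; try by case: eqP.
case: tpermP => [->|->|/eqP/negbTE k1 /eqP/negbTE k2];
  by rewrite ?eqxx ?[r == ord0]eq_sym ?lr -/r ?k1 ?k2.
Qed.

Arguments lkey : simpl never.
Arguments rkey : simpl never.
Arguments gen_act : simpl never.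

Fixpoint descending b (r : seq (gen n)) : bool :=
  if r is g :: r' then (rkey g b < lkey g b) && descending (gen_act g b) r'
  else true.

Definition word_act b (r : seq (gen n)) : T := foldl (fun b g => gen_act g b) b r.

(** For neighbouring swaps, letters [x > y > z] are reversed one inversion at a time along either
    word. At the double bond, both first letters are negative, and either word changes both signs in
    place. *)
Lemma descending_pair g h b : let m := coxeter_order g h in
  rkey g b < lkey g b -> rkey h b < lkey h b ->
  [/\ descending b (alternating_word m g h),
      descending b (alternating_word m h g) &
      word_act b (alternating_word m g h) = word_act b (alternating_word m h g)].
Proof.
move: b => /[swap] m; rewrite /m {m}.
apply: (coxeter_ind (P := fun m g h => forall b,
  rkey g b < lkey g b -> rkey h b < lkey h b ->
  [/\ descending b (alternating_word m g h),
      descending b (alternating_word m h g) &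
      word_act b (alternating_word m g h)
      = word_act b (alternating_word m h g)])).
- by move=> m {}g {}h H b d1 d2; have [] := H b d2 d1; split.
- by move=> {}g b d1 _; rewrite /= d1.
- move=> {}g {}h gh b d1 d2; have [e e1 e2 e3 e4] := far_act b gh.
  by rewrite /word_act /= e1 e2 e3 e4 d1 d2 e.
- move=> i j ij b.
  have [U [x [y [z [-> [L1 R1 E1] [L2 R2 E2]]]]]] := adjacent_act b ij.
  rewrite /word_act /= !(E1, E2, L1, L2, R1, R2) => xy yz.
  by rewrite xy yz (lt_trans yz xy).
- move=> i i0 b; have [U [x [y [-> [L1 R1 E1] [L2 R2 E2]]]]] := sign_act b i0.
  rewrite /word_act /= !(E1, E2, L1, L2, R1, R2) flip_gt => xx yx.
  by rewrite !flip_neg ?(lt_trans yx xx) //; split=> //; lia.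
Qed.

(** Rules out two distinct unsigned letters at the double bond, the one case in which
    [descending_fixed] could fail. *)
Definition one_fixed_letter b := forall i j : 'I_n.+1,
  `|b i| <= theta%:Z -> `|b j| <= theta%:Z -> b i = b j.

(** The braid relation reads [g r = r k]: the question how [g] acts at a sequence that it fixes is
    passed to [k] at the lower end of [r], which [k] fixes. *)
Lemma descending_fixed g h b : let m := coxeter_order g h in
  one_fixed_letter b -> lkey g b = rkey g b -> rkey h b < lkey h b ->
  exists r k, [/\ alternating_word m g h = g :: r,
    alternating_word m h g = rcons r k, descending b r &
    lkey k (word_act b r) = rkey k (word_act b r)].
Proof.
pose P m g h := forall b, one_fixed_letter b ->
    lkey g b = rkey g b -> rkey h b < lkey h b ->
  exists r k, [/\ alternating_word m g h = g :: r,
    alternating_word m h g = rcons r k, descending b r &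
    lkey k (word_act b r) = rkey k (word_act b r)].
suff /(_ b) : P (coxeter_order g h) g h by [].
suff [] : P (coxeter_order g h) g h /\ P (coxeter_order g h) h g by [].
apply: (coxeter_ind (P := fun m g h => P m g h /\ P m h g)) => {b g h}.
- by move=> m g h [].
- by move=> g; split=> b _ ->; rewrite ltxx.
- move=> g h gh; split=> b _; have [e e1 e2 e3 e4] := far_act b gh => f d.
    by exists [:: h], g; rewrite /word_act /= d e1 e2.
  by exists [:: g], h; rewrite /word_act /= d e3 e4.
- move=> i j ij; split=> b _.
    have [U [x [y [z [-> [L1 R1 E1] [L2 R2 E2]]]]]] := adjacent_act b ij.
    rewrite L1 R1 L2 R2 => <- zy; exists [:: Some j; Some i], (Some j).
    by rewrite /word_act /= !(E1, E2, L1, L2, R1, R2) zy.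
  have [U [x [y [z [-> [L1 R1 E1] [L2 R2 E2]]]]]] := adjacent_act b ij.
  rewrite L1 R1 L2 R2 => <- zy; exists [:: Some i; Some j], (Some i).
  by rewrite /word_act /= !(E1, E2, L1, L2, R1, R2) zy.
- move=> i i0; split=> b nb.
    have : `|rkey None b| <= theta%:Z -> `|rkey (Some i) b| <= theta%:Z ->
        rkey None b = rkey (Some i) b by exact: nb.
    have [U [x [y [-> [L1 R1 E1] [L2 R2 E2]]]]] := sign_act b i0.
    rewrite L1 R1 L2 R2 => xy /eqP; rewrite flip_fixed => xF yx.
    exists [:: Some i; None; Some i], None.
    rewrite /word_act /= !(E1, E2, L1, L2, R1, R2) flip_gt.
    (* Since [y] differs from the unsigned letter [x], it carries a sign; being below [x], it is
       negative. *)
    have y0 : y < - theta%:Z by lia.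
    rewrite [flip y]flip_neg //; split=> //; try lia.
    by apply/eqP; rewrite flip_fixed.
  have [U [x [y [-> [L1 R1 E1] [L2 R2 E2]]]]] := sign_act b i0.
  rewrite L1 R1 L2 R2 => <-; rewrite flip_gt => x0.
  exists [:: None; Some i; None], (Some i).
  rewrite /word_act /= !(E1, E2, L1, L2, R1, R2) flip_gt.
  by rewrite !flip_neg //; split=> //; lia.
Qed.
End Arrangements.

Arguments lkey : simpl never.
Arguments rkey : simpl never.
Arguments gen_act : simpl never.

(** * Computing with classes of terms *)

Section HeckeClasses.
Variables (A : comNzRingType) (q : A) (n : nat).
Implicit Types x y : hterm A n.

Lemma hclassD x y : hclass q (HAdd x y) = hclass q x + hclass q y.
Proof. by apply/hclassP; apply: hcong_add; apply/hcong_sym/hcong_repr. Qed.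

Lemma hclassM x y : hclass q (HMul x y) = hclass q x * hclass q y.
Proof. by apply/hclassP; apply: hcong_mul; apply/hcong_sym/hcong_repr. Qed.

Lemma hclassZ a x : hclass q (HMul (HConst n a) x) = a *: hclass q x.
Proof.
by apply/hclassP; apply: hcong_mul (hcong_refl _ _) _; apply/hcong_sym/hcong_repr.
Qed.

Lemma hclassC a : hclass q (HConst n a) = a%:A.
Proof.
rewrite -[1]/(hclass q (HConst n 1)) -hclassZ; apply/hclassP/hcong_sym.
by apply: hcong_trans (hcong_constM _ _ _ _) _; rewrite mulr1; apply: hcong_refl.
Qed.

End HeckeClasses.

(** * Hecke modules from operators *)

Section HeckeAction.
Variables (A : comNzRingType) (q : A) (n : nat) (V : lmodType A).
Variable T : gen n -> V -> V.

(** The relations are stated pointwise, so that terms act directly on [V] and no algebra of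
    endomorphisms has to be formed. *)
Definition hecke_action_rel : Prop :=
  [/\ forall g a u v, T g (a *: u + v) = a *: T g u + T g v,
      forall g v, T g (T g v) = (q - 1) *: T g v + q *: v &
      forall g h v, let m := coxeter_order g h in
        foldr T v (alternating_word m g h)
        = foldr T v (alternating_word m h g)].

Fixpoint hterm_act (x : hterm A n) (v : V) : V :=
  match x with
  | HGen g => T g v
  | HConst a => a *: v
  | HAdd y z => hterm_act y v + hterm_act z v
  | HMul y z => hterm_act y (hterm_act z v)
  end.

Lemma hterm_act_word r v : hterm_act (hword A r) v = foldr T v r.
Proof. by elim: r => [|g r IHr] /=; rewrite ?scale1r ?IHr. Qed.

Hypothesis relT : hecke_action_rel.

Lemma hterm_act_linear x a u v :
  hterm_act x (a *: u + v) = a *: hterm_act x u + hterm_act x v.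
Proof.
have [linT _ _] := relT.
elim: x u v => //= [b|y IHy z IHz|y IHy z IHz] u v.
- by rewrite scalerDr !scalerA mulrC.
- by rewrite IHy IHz scalerDr addrACA.
- by rewrite IHz IHy.
Qed.

Lemma hterm_act_scale x a v : hterm_act x (a *: v) = a *: hterm_act x v.
Proof.
have act0 : hterm_act x 0 = 0.
  apply: (addrI (hterm_act x 0)).
  by have := hterm_act_linear x 1 0 0; rewrite scaler0 !scale1r !addr0.
by have := hterm_act_linear x a v 0; rewrite act0 !addr0.
Qed.

(** Linearity of the operators accounts for centrality of constants and for distributivity over a
    sum in the right factor; the other cases are module axioms or assumed relations. *)
Lemma hterm_act_cong x y : hcong q x y -> hterm_act x =1 hterm_act y.
Proof.
have [_ quadT braidT] := relT.
have actD z u v : hterm_act z (u + v) = hterm_act z u + hterm_act z v.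
  by have := hterm_act_linear z 1 u v; rewrite !scale1r.
elim=> /= {x y}.
- by [].
- by move=> x y _ xy v; rewrite xy.
- by move=> y x z _ xy _ yz v; rewrite xy.
- by move=> x x' y y' _ xx' _ yy' v /=; rewrite xx' yy'.
- by move=> x x' y y' _ xx' _ yy' v /=; rewrite yy' xx'.
- by move=> x y z v /=; rewrite addrA.
- by move=> x y v /=; rewrite addrC.
- by move=> x v /=; rewrite scale0r add0r.
- by move=> x v /=; rewrite scaleN1r addNr scale0r.
- by [].
- by move=> x v /=; rewrite scale1r.
- by [].
- by move=> x y z v /=; rewrite actD.
- by move=> a b v /=; rewrite scalerDl.
- by move=> a b v /=; rewrite scalerA.
- by move=> a x v /=; rewrite hterm_act_scale.
- by move=> g v /=; rewrite quadT.
- by move=> g h v; rewrite !hterm_act_word braidT.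
Qed.

Definition hecke_act (x : hecke q n) : V -> V := hterm_act (repr x).

Lemma hecke_actE x : hecke_act (hclass q x) =1 hterm_act x.
Proof. exact/hterm_act_cong/hcong_repr. Qed.

Lemma hecke_act_scale x a v : hecke_act x (a *: v) = a *: hecke_act x v.
Proof. exact: hterm_act_scale. Qed.

Lemma hecke_act_add x u v : hecke_act x (u + v) = hecke_act x u + hecke_act x v.
Proof. by have := hterm_act_linear (repr x) 1 u v; rewrite !scale1r. Qed.

Lemma hecke_actD x y v : hecke_act (x + y) v = hecke_act x v + hecke_act y v.
Proof.
by elim/hclassW: x => x; elim/hclassW: y => y; rewrite -hclassD !hecke_actE.
Qed.

Lemma hecke_actM x y v : hecke_act (x * y) v = hecke_act x (hecke_act y v).
Proof.
by elim/hclassW: x => x; elim/hclassW: y => y; rewrite -hclassM !hecke_actE.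
Qed.

Lemma hecke_actZ a x v : hecke_act (a *: x) v = a *: hecke_act x v.
Proof. by elim/hclassW: x => x; rewrite -hclassZ !hecke_actE. Qed.

Lemma hecke_act1 v : hecke_act 1 v = v.
Proof. by rewrite (hecke_actE (HConst n 1)) /= scale1r. Qed.

Lemma hecke_act_gen g v : hecke_act (hecke_gen q g) v = T g v.
Proof. exact: (hecke_actE (HGen A g)). Qed.

End HeckeAction.

(** * The module of functions on sequences *)

Section ArrangementAction.
Variables (A : comNzRingType) (q c : A) (n theta : nat).
Local Notation T := {ffun 'I_n.+1 -> int}.
Implicit Types (b : T) (g h : gen n) (f : T -> A^o).

(* With l and r the keys of b at g, T_g b = diag_coef l r b + move_coef l r (g b)
   on basis vectors; [gen_op] is this operator on coefficient families. *)
Definition diag_coef (l r : int) : A :=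
  if l == r then c else if r < l then q - 1 else 0.
Definition move_coef (l r : int) : A :=
  if l == r then 0 else if r < l then q else 1.

Definition gen_op g f : T -> A^o := fun b =>
  diag_coef (lkey theta g b) (rkey g b) * f b
  + move_coef (rkey g b) (lkey theta g b) * f (gen_act theta g b).

Hypothesis cq : constant_rel q c.

(** A generator exchanges its two keys, so the quadratic relation involves only [b] and its image.
    The braid relations are polynomial identities, one for each relative order of the letters
    moved. *)
Lemma gen_op_rel : hecke_action_rel q gen_op.
Proof.
have cc : c * c = (q - 1) * c + q by rewrite -expr2 cq.
split.
- move=> g a u v; apply/funext => b; rewrite /gen_op !fctE.
  rewrite /GRing.scale /=; ring.
- move=> g f; apply/funext => b; rewrite /gen_op !fctE /GRing.scale /=.
  rewrite gen_actK lkey_act rkey_act /diag_coef /move_coef.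
  case: ltgtP => [_|_|e]; try ring.
  rewrite !mul0r !addr0 mulrA cc; ring.
move=> g h f m; apply/funext => b; rewrite {}/m; move: b f.
apply: (coxeter_ind (P := fun m g h => forall b f,
  foldr gen_op f (alternating_word m g h) b
  = foldr gen_op f (alternating_word m h g) b)) => [m {}g {}h H b f||||].
- by rewrite H.
- by [].
- move=> {}g {}h gh b f; have [e e1 e2 e3 e4] := far_act theta b gh.
  rewrite /= /gen_op e1 e2 e3 e4 e; ring.
- move=> i j ij b f.
  have [U [x [y [z [-> [L1 R1 E1] [L2 R2 E2]]]]]] := adjacent_act theta b ij.
  have op1 f' x' y' z' : gen_op (Some i) f' (U x' y' z')
    = diag_coef x' y' * f' (U x' y' z') + move_coef y' x' * f' (U y' x' z').
    by rewrite /gen_op L1 R1 E1.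
  have op2 f' x' y' z' : gen_op (Some j) f' (U x' y' z')
    = diag_coef y' z' * f' (U x' y' z') + move_coef z' y' * f' (U x' z' y').
    by rewrite /gen_op L2 R2 E2.
  rewrite /= !(op1, op2) /diag_coef /move_coef.
  case: (ltgtP x y) => xy; case: (ltgtP y z) => yz; case: (ltgtP x z) => xz;
    try lia; try subst y; try subst z; rewrite ?(mul0r, add0r, addr0, mul1r);
    try by ring: cc.
- move=> i i0 b f.
  have [U [x [y [-> [L1 R1 E1] [L2 R2 E2]]]]] := sign_act theta b i0.
  have op1 f' x' y' : gen_op None f' (U x' y') =
    diag_coef (flip theta x') x' * f' (U x' y')
    + move_coef x' (flip theta x') * f' (U (flip theta x') y').
    by rewrite /gen_op L1 R1 E1.
  have op2 f' x' y' : gen_op (Some i) f' (U x' y')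
    = diag_coef x' y' * f' (U x' y') + move_coef y' x' * f' (U y' x').
    by rewrite /gen_op L2 R2 E2.
  have flipP z : `|z| <= theta%:Z /\ flip theta z = z
              \/ (theta%:Z < `|z|) /\ flip theta z = - z.
    by rewrite /flip; case: ifP; lia.
  rewrite /= !(op1, op2) !flipK.
  (* With the flipped letters abstracted, the coefficients depend only on the order of [x], [y],
     [X], [Y]; inconsistent orders are discarded. *)
  move: (flip theta x) (flip theta y) (flipP x) (flipP y) => X Y HX HY.
  rewrite /diag_coef /move_coef.
  case: (ltgtP X x) => Xx; try (exfalso; lia);
  case: (ltgtP Y y) => Yy; try (exfalso; lia);
  case: (ltgtP x y) => xy; try (exfalso; lia);
  case: (ltgtP x Y) => xY; try (exfalso; lia);
  case: (ltgtP X y) => Xy; try (exfalso; lia);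
  case: (ltgtP X Y) => XY; try (exfalso; lia).
all: clear HX HY; try subst X; try subst Y; try subst y.
all: rewrite ?(mul0r, add0r, addr0, mul1r).
all: try by ring: cc.
Qed.
End ArrangementAction.

(** * A length that descents decrease *)

Section Length.
Variables (n theta : nat).
Local Notation T := {ffun 'I_n.+1 -> int}.
Implicit Types (b : T) (g : gen n).

Let total b : int := \sum_k `|b k|.

(* Since [total] is invariant, a descent strictly decreases this weighted sum
   of nonnegative terms. *)
Definition arr_length b : nat := `|(\sum_(k < n.+1) (k.+1)%:Z * (total b - b k))%R|%N.

Let total_act g b : total (gen_act theta g b) = total b.
Proof.
case: g => [i|]; rewrite /total.
  rewrite [RHS](reindex_inj (@perm_inj _ (tperm (left_dot i) (right_dot i)))).
  by apply: eq_bigr => k _; rewrite ffunE.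
apply: eq_bigr => k _; rewrite ffunE /flip.
by case: ifP => // _; case: ifP => //; rewrite normrN.
Qed.

Lemma arr_length_act g b : rkey g b < lkey theta g b ->
  (arr_length (gen_act theta g b) < arr_length b)%N.
Proof.
move=> d; rewrite /arr_length -ltz_nat !gez0_abs; last 2 first.
- apply: sumr_ge0 => k _; apply: mulr_ge0 => //.
  rewrite subr_ge0 /total (bigD1 k) //=; apply: ler_wpDr; last exact: ler_norm.
  by apply: sumr_ge0.
- apply: sumr_ge0 => k _; apply: mulr_ge0 => //.
  rewrite subr_ge0 /total (bigD1 k) //=; apply: ler_wpDr; last exact: ler_norm.
  by apply: sumr_ge0.
rewrite total_act -subr_gt0 -sumrB.
under eq_bigr => k _ do rewrite -mulrBr opprD opprK addrACA subrr add0r addrC.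
(* Neighbouring weights differ by one, so a swap contributes the difference of its keys; a sign
   change contributes the growth of the first letter, at weight one. *)
case: g d => [i|] d.
  rewrite (bigD1 (left_dot i)) //= (bigD1 (right_dot i)) /=; last first.
    by rewrite eq_sym dots_neq.
  rewrite big1 => [|k /andP[k1 k2]]; last first.
    by rewrite ffunE tpermD 1?eq_sym // subrr mulr0.
  rewrite !ffunE tpermL tpermR /bump /=.
  move: d; rewrite /rkey /lkey; lia.
rewrite (bigD1 ord0) //= big1 => [|k /negbTE k0]; last first.
  by rewrite ffunE k0 subrr mulr0.
by move: d; rewrite ffunE eqxx /rkey /lkey; lia.
Qed.
End Length.

(** * The orbit of the minimal sequence *)

Section Orbit.
Variables (n : nat) (J : {set gen n}).
Local Notation T := {ffun 'I_n.+1 -> int}.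
Local Notation theta := (gen_t \in J : nat).
Implicit Types (b : T) (g h : gen n).

(** The index, from 0, of the block containing the dot [k]. *)
Definition block (k : nat) : nat := count (leq^~ k) (bars J).

Lemma blockE k :
  block k = (\sum_(i < n) ((gen_s i \notin J) && (i < k)))%N.
Proof.
rewrite /block /bars count_map count_filter -sum1_count big_enum_cond big_mkcond.
by apply: eq_bigr => i _; rewrite /= andbC; case: ifP.
Qed.

Lemma leq_block : {homo block : k l / (k <= l)%N}.
Proof. by move=> k l kl; apply: sub_count => m /= mk; apply: leq_trans kl. Qed.

Lemma block_step (i : 'I_n) : (block i == block i.+1) = (gen_s i \in J).
Proof.
rewrite !blockE (bigD1 i) //= [in X in _ == X](bigD1 i) //= ltnn ltnSn andbT andbF.
set A := (X in (0 + X)%N == _); set B := (X in _ == (_ + X)%N).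
suff -> : B = A by case: (gen_s i \in J) => /=; lia.
by apply: eq_bigr => k ki; rewrite ltnS leq_eqVlt (inj_eq val_inj) (negbTE ki).
Qed.

Definition base : T := [ffun k : 'I_n.+1 => (block k).+1%:Z].

(** The conditions that do not involve [K], phrased through [perm_eq] to make stability under the
    generators easy; [admissible0] recovers the original form. *)
Definition arrangement b : bool :=
  perm_eq [seq `|b k|%N | k : 'I_n.+1] [seq `|base k|%N | k : 'I_n.+1]
  && ((gen_t \in J) ==> [forall k, b k != -1]).

Lemma base_arrangement : arrangement base.
Proof.
rewrite /arrangement perm_refl; apply/implyP => _; apply/forallP => k.
by rewrite ffunE.
Qed.

Lemma arrangement_abs b k : arrangement b ->
  exists l : 'I_n.+1, `|b k|%N = (block l).+1.
Proof.
case/andP=> /perm_mem e _.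
have : `|b k|%N \in [seq `|b k|%N | k : 'I_n.+1] by apply: image_f.
by rewrite e => /imageP[l _ ->]; exists l; rewrite ffunE.
Qed.

Lemma arrangement_neq0 b k : arrangement b -> b k != 0.
Proof. by move=> /(arrangement_abs k)[l]; case: eqP => // ->. Qed.

Lemma arrangement_fixed b k : arrangement b ->
  (`|b k| <= theta%:Z) = (b k == 1) && (gen_t \in J).
Proof.
move=> Ob; have := arrangement_neq0 k Ob; case/andP: Ob => _.
by case: (gen_t \in J) => /= [/forallP/(_ k)|_]; lia.
Qed.

Lemma arrangement_one_fixed b : arrangement b -> one_fixed_letter theta b.
Proof.
by move=> Ob i j; rewrite !arrangement_fixed // => /andP[/eqP-> _] /andP[/eqP-> _].
Qed.

Lemma arrangement_act g b : arrangement b -> arrangement (gen_act theta g b).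
Proof.
case/andP=> bp b1; rewrite /arrangement; case: g => [i|]; apply/andP; split.
- apply: perm_trans bp.
  rewrite (eq_image (g := (fun k => `|b k|%N) \o tperm (left_dot i) (right_dot i))
                    (B := predT)) //; last by move=> k; rewrite /= ffunE.
  rewrite /image_mem map_comp; apply: perm_map; apply: uniq_perm.
  + by rewrite map_inj_uniq ?enum_uniq //; apply: perm_inj.
  + exact: enum_uniq.
  move=> k; rewrite mem_enum; apply/mapP.
  exists (tperm (left_dot i) (right_dot i) k); rewrite ?mem_enum //.
  by rewrite tpermK.
- apply/implyP => tJ; apply/forallP => k; rewrite ffunE.
  by move: b1; rewrite tJ => /forallP.
- apply: perm_trans bp; rewrite (eq_image (g := fun k => `|b k|%N) (B := predT)) //.
  by move=> k; rewrite ffunE; case: eqP => // ->; rewrite /flip; case: ifP; lia.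
apply/implyP => tJ; apply/forallP => k; rewrite ffunE.
move: b1; rewrite tJ => /forallP/(_ k); case: (k =P ord0) => // ->.
by rewrite /flip; case: ifP; lia.
Qed.

Lemma base_fixed g : (lkey theta g base == rkey g base) = (g \in J).
Proof.
case: g => [i|]; rewrite /lkey /rkey; first by rewrite !ffunE -block_step.
rewrite flip_fixed arrangement_fixed ?base_arrangement // ffunE.
rewrite /block; case: (gen_t \in J); rewrite ?andbF // andbT.
(* Every bar has a dot to its left, so dot 0 lies in block 0 and [base] starts with 1. *)
by apply/eqP; congr Posz; congr S; apply/eqP; rewrite -leqn0 leqNgt -has_count;
  apply/hasPn => x /mapP[i _ ->].
Qed.

Lemma base_min g : lkey theta g base <= rkey g base.
Proof.
case: g => [i|]; rewrite /lkey /rkey !ffunE.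
  by rewrite lez_nat ltnS leq_block // /bump /=.
by rewrite leNgt flip_gt; lia.
Qed.

(** Without descents the letters increase weakly from a positive first letter, so [b] is the sorted
    list of the prescribed absolute values. *)
Lemma arrangement_min b : arrangement b ->
  (forall g, lkey theta g b <= rkey g b) -> b = base.
Proof.
move=> Ob min_b.
(* Clamping the index at [n] extends [b] to all natural numbers, where monotonicity follows from
   single steps. *)
have mono : {homo (fun k => b (inord (minn k n))) : k l / (k <= l)%N >-> k <= l}.
  apply: homo_leq => /= [//|y x z|k]; first exact: le_trans.
  case: (ltnP k n) => kn; last first.
    by rewrite (minn_idPr (leq_trans kn (leqnSn k))).
  rewrite (minn_idPl kn).
  have := min_b (Some (Ordinal kn)); rewrite /lkey /rkey.
  suff [-> ->] : left_dot (Ordinal kn) = inord k /\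
                 right_dot (Ordinal kn) = inord k.+1 by [].
  split; apply: val_inj; rewrite /= inordK //; lia.
have {mono} mono (k l : 'I_n.+1) : (k <= l)%N -> b k <= b l.
  move=> kl; have /= := mono _ _ kl.
  by rewrite !(minn_idPl _) -1?ltnS ?ltn_ord // !inord_val.
have pos k : 0 < b k.
  apply: lt_le_trans (mono ord0 k (leq0n _)).
  (* As [t] is no descent, the first letter is at least [- theta]; 0 never occurs, and -1 is
     excluded when [theta] is 1. *)
  have := min_b None; rewrite /lkey /rkey leNgt flip_gt.
  have := arrangement_fixed ord0 Ob; have := arrangement_neq0 ord0 Ob.
  by case: (gen_t \in J) => /=; case: eqP; lia.
case/andP: (Ob) => bp _.
have sorted_abs (f : T) : (forall k l : 'I_n.+1, (k <= l)%N -> (`|f k| <= `|f l|)%N) ->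
    sorted leq [seq `|f k|%N | k : 'I_n.+1].
  move=> H; rewrite sorted_map.
  apply: (sub_sorted (e := relpre val leq)) => [k l|]; first exact: H.
  by rewrite -sorted_map val_enum_ord iota_sorted.
have : [seq `|b k|%N | k : 'I_n.+1] = [seq `|base k|%N | k : 'I_n.+1].
  apply: sorted_eq bp; [exact: leq_trans|exact: anti_leq| |].
    by apply: sorted_abs => k l /mono; have := pos k; have := pos l; lia.
  by apply: sorted_abs => k l kl; rewrite !ffunE /= ltnS leq_block.
move=> /eq_in_map e; apply/ffunP => k; have := e k (mem_enum _ _).
by have := pos k; rewrite /= ffunE; lia.
Qed.
End Orbit.

Lemma coxeter_orderC n (g h : gen n) : coxeter_order g h = coxeter_order h g.
Proof. by rewrite /coxeter_order minnC maxnC. Qed.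

Lemma coxeter_order_gt0 n (g h : gen n) : (0 < coxeter_order g h)%N.
Proof. by rewrite /coxeter_order; do 3?case: ifP. Qed.

Lemma alternating_word_cons n (g h : gen n) :
  exists s, alternating_word (coxeter_order g h) g h = g :: s.
Proof.
exists (behead (alternating_word (coxeter_order g h) g h)).
by case: coxeter_order (coxeter_order_gt0 g h).
Qed.

Lemma hecke_word_cons (A : comNzRingType) (q : A) n (g : gen n) s :
  hecke_word q (g :: s) = hecke_gen q g * hecke_word q s.
Proof. exact: big_cons. Qed.

(** * Cyclic modules generated by a common eigenvector *)

Section CyclicModule.
Variables (A : comNzRingType) (q c : A) (cq : constant_rel q c).
Variables (n : nat) (J : {set gen n}).
Variables (M : lmodType (hecke q n)) (v0 : M).
Hypothesis v0_fixed : forall g, g \in J -> hecke_gen q g *: v0 = c%:A *: v0.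

Local Notation T := {ffun 'I_n.+1 -> int}.
Local Notation theta := (gen_t \in J : nat).
Local Notation lkey := (lkey theta).
Local Notation gen_act := (gen_act theta).
Local Notation base := (base J).
Local Notation arrangement := (arrangement J).
Local Notation gen_op := (gen_op q c theta).
Implicit Types (b : T) (g h : gen n) (u v : M).

(** A relation, since the vector could a priori depend on the chain of descents from [b] to
    [base]. *)
Inductive arr_vector : T -> M -> Prop :=
  | arr_vector_base : arr_vector base v0
  | arr_vector_step g b v : rkey g b < lkey g b ->
      arr_vector (gen_act g b) v -> arr_vector b (hecke_gen q g *: v).

Lemma arr_vector_word b r v : descending theta b r ->
  arr_vector (word_act theta b r) v -> arr_vector b (hecke_word q r *: v).
Proof.
rewrite /hecke_word.
elim: r b => [|g r IHr] b /=; first by rewrite big_nil scale1r.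
move=> /andP[d1 d2] av; rewrite big_cons -scalerA.
by apply: arr_vector_step => //; apply: IHr.
Qed.

Lemma arr_vector_inv b v : arr_vector b v ->
  (b = base /\ v = v0) \/ exists g v1,
    [/\ rkey g b < lkey g b, arr_vector (gen_act g b) v1 & v = hecke_gen q g *: v1].
Proof. by case=> [|g b' v' d av]; [left|right; exists g, v']. Qed.

Lemma word_act_orbit b r : arrangement b -> arrangement (word_act theta b r).
Proof. by elim: r b => //= g r IHr b Ob; apply/IHr/arrangement_act. Qed.

Lemma descending_length b r : descending theta b r ->
  (arr_length (word_act theta b r) <= arr_length b)%N.
Proof.
elim: r b => //= g r IHr b /andP[d /IHr]; move/leq_trans; apply.
exact/ltnW/arr_length_act.
Qed.

(** The claims need a joint induction on length: uniqueness at [b] uses existence and uniqueness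
    below, and the eigenvector claim uses uniqueness at [b] and the eigenvector claim below. *)
Lemma arr_vectorP b : arrangement b ->
  [/\ exists v, arr_vector b v,
      forall v v', arr_vector b v -> arr_vector b v' -> v = v' &
      forall g v, lkey g b = rkey g b -> arr_vector b v ->
        hecke_gen q g *: v = c%:A *: v].
Proof.
have [k] := ubnP (arr_length b); elim: k b => // k IHk b; rewrite ltnS => bk Ob.
have IH g r : descending theta b (g :: r) ->
    [/\ exists v, arr_vector (word_act theta b (g :: r)) v,
        forall v v', arr_vector (word_act theta b (g :: r)) v ->
          arr_vector (word_act theta b (g :: r)) v' -> v = v' &
        forall h v, lkey h (word_act theta b (g :: r))
                    = rkey h (word_act theta b (g :: r)) ->
          arr_vector (word_act theta b (g :: r)) v ->
          hecke_gen q h *: v = c%:A *: v].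
  move=> /= /andP[d dr]; apply: IHk; last exact: (@word_act_orbit _ (g :: r)).
  apply: leq_trans bk; apply: leq_ltn_trans (descending_length dr) _.
  exact: arr_length_act.
case: (boolP [forall g : gen n, lkey g b <= rkey g b]) => [/forallP min_b|].
  have eb := arrangement_min Ob min_b.
  have v0U v : arr_vector b v -> v = v0.
    move=> /arr_vector_inv[[]//|[g [v1 [d]]]].
    by have := min_b g; rewrite leNgt d.
  split=> [|v v' /v0U-> /v0U->//|g v e /v0U->].
    by exists v0; rewrite eb; apply: arr_vector_base.
  by apply: v0_fixed; rewrite -base_fixed -eb e.
rewrite negb_forall => /existsP[h]; rewrite -ltNge => dh.
have inv v : arr_vector b v -> exists g v1,
    [/\ rkey g b < lkey g b, arr_vector (gen_act g b) v1 & v = hecke_gen q g *: v1].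
  move=> /arr_vector_inv[[eb _]|//].
  by have := base_min J h; rewrite leNgt -eb dh.
have step g v : rkey g b < lkey g b -> arr_vector (gen_act g b) v ->
    forall v', arr_vector (gen_act g b) v' -> v = v'.
  move=> d av v' av'; have [_ U _] := IH g [::] (etrans (andbT _) d).
  exact: U.
have exb : exists v, arr_vector b v.
  have [[v av] _ _] := IH h [::] (etrans (andbT _) dh).
  by exists (hecke_gen q h *: v); apply: arr_vector_step.
have uniqb v v' : arr_vector b v -> arr_vector b v' -> v = v'.
  move=> /inv[g [v1 [d av ->]]] /inv[g' [v1' [d' av' ->]]].
  have [gg'|gg'] := eqVneq g g'.
    by subst g'; rewrite (step _ _ d av _ av').
  (* Both chains may be rerouted through the common end of the two alternating words, where the
     braid relation identifies the products. *)
  have [d1 d2 e] := descending_pair d d'.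
  have [s es] := alternating_word_cons g g'.
  have [s' es'] := alternating_word_cons g' g.
  rewrite [coxeter_order g' g]coxeter_orderC in es'.
  rewrite es in d1 e; rewrite es' in d2 e.
  have [[w aw] _ _] := IH _ _ d1.
  move/andP: (d1) => [_ ds]; move/andP: (d2) => [_ ds'].
  rewrite (step _ _ d av _ (arr_vector_word ds aw)).
  rewrite e in aw; rewrite (step _ _ d' av' _ (arr_vector_word ds' aw)).
  rewrite !scalerA -!hecke_word_cons -es -es'.
  by congr (_ *: w); apply: (hecke_genP q n).2.
split=> // g v e av.
have [s [l [es es' ds ls]]] := descending_fixed (arrangement_one_fixed Ob) e dh.
(* An empty [s] would force [l = h], but a descent does not fix [b]. *)
case: s es' es ds ls => [|h' s] es' es ds ls.
  have [s eh] := alternating_word_cons h g.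
  move: es'; rewrite coxeter_orderC eh => -[hk _].
  by move: dh ls; rewrite /= hk => /[swap] ->; rewrite ltxx.
have [[w aw] _ /(_ l w ls aw) lw] := IH _ _ ds.
(* The braid relation moves [g] past the descending word, turning it into [l], which acts on [w] by
   [c]. *)
rewrite (uniqb _ _ av (arr_vector_word ds aw)) scalerA -hecke_word_cons -es.
have -> : hecke_word q (alternating_word (coxeter_order g h) g h)
        = hecke_word q (alternating_word (coxeter_order g h) h g).
  exact: (hecke_genP q n).2.
rewrite es' {1}/hecke_word big_rcons /= -scalerA lw !scalerA.
by rewrite mulr_algl mulr_algr.
Qed.

(** An ascent extends a chain, a descent is the quadratic relation applied to the ascent below it,
    and a fixed sequence is the eigenvector claim. *)
Lemma arr_vector_basis : exists x : T -> M,
  [/\ x base = v0, forall b, arrangement b -> arr_vector b (x b) &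
      forall b g, arrangement b -> hecke_gen q g *: x b
        = (diag_coef q c (lkey g b) (rkey g b))%:A *: x b
          + (move_coef q (lkey g b) (rkey g b))%:A *: x (gen_act g b)].
Proof.
have exx b : exists v, arrangement b -> arr_vector b v.
  have [Ob|_] := boolP (arrangement b); last by exists 0.
  by have [[v av] _ _] := arr_vectorP Ob; exists v.
have /choice[x xP] := exx; exists x.
have xU b v : arrangement b -> arr_vector b v -> x b = v.
  by move=> Ob av; have [_ U _] := arr_vectorP Ob; apply: U => //; apply: xP.
have O0 := base_arrangement J.
have asc b g : arrangement b -> lkey g b < rkey g b ->
    x (gen_act g b) = hecke_gen q g *: x b.
  move=> Ob d; apply: xU; first exact: arrangement_act.
  apply: arr_vector_step; first by rewrite lkey_act rkey_act.
  by rewrite gen_actK; apply: xP.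
split=> // [|b g Ob]; first by apply: xU => //; apply: arr_vector_base.
rewrite /diag_coef /move_coef; case: (ltgtP (lkey g b)) => [d|d|e].
- by rewrite scale0r scale0r add0r !scale1r asc.
- have -> : x b = hecke_gen q g *: x (gen_act g b).
    rewrite -asc ?gen_actK //; first exact: arrangement_act.
    by rewrite lkey_act rkey_act.
  by rewrite !scalerA -scalerDl -expr2 (hecke_genP q n).1 mulr_algl.
- have [_ _ U] := arr_vectorP Ob; rewrite (U g _ e (xP b Ob)).
  by rewrite scale0r scale0r addr0.
Qed.

Variable O : seq T.
Hypotheses (uniqO : uniq O) (memO : forall b, (b \in O) = arrangement b).

Let act : hecke q n -> (T -> A^o) -> (T -> A^o) := hecke_act gen_op.
Definition arr_delta b : T -> A^o := fun b' => (b' == b)%:R.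

Variable phi : M -> (T -> A^o).
Hypotheses (phiD : forall u v, phi (u + v) = phi u + phi v)
  (phiH : forall (k : hecke q n) u, phi (k *: u) = act k (phi u))
  (phi0 : phi v0 = arr_delta base)
  (cyclicM : forall u, exists k : hecke q n, u = k *: v0).

(** Both [phi] and [psi] commute with the algebra. As [psi] after [phi] fixes the generator [v0], it
    is the identity, which gives spanning; independence holds because [phi] sends [x b] to
    [arr_delta b]. *)
Lemma cyclic_character (h : hecke q n) :
  is_character_value M h (\sum_(b <- O) act h (arr_delta b) b).
Proof.
have [x [x0 xP xg]] := arr_vector_basis.
have relT := gen_op_rel n theta cq.
pose psi (f : T -> A^o) : M := \sum_(b <- O) (f b : A)%:A *: x b.
have psiD f f' : psi (f + f') = psi f + psi f'.
  by rewrite -big_split; apply: eq_bigr => b _; rewrite !fctE !scalerDl.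
have psiZ a f : psi (a *: f) = a%:A *: psi f.
  rewrite scaler_sumr; apply: eq_bigr => b _.
  by rewrite scalerA mulr_algl scalerA.
have psi_gen g f : hecke_gen q g *: psi f = psi (gen_op g f).
  (* A generator permutes the arrangements, so the moved terms can be reindexed. *)
  have pO : perm_eq O [seq gen_act g b | b <- O].
    apply: uniq_perm => //.
      by rewrite map_inj_uniq //; apply: inv_inj; apply: gen_actK.
    move=> b; rewrite memO; apply/idP/mapP => [Ob|[b' Ob' ->]].
      by exists (gen_act g b); rewrite ?gen_actK // memO arrangement_act.
    by rewrite arrangement_act // -memO.
  transitivity (\sum_(b <- O) ((diag_coef q c (lkey g b) (rkey g b) * f b)%:A *: x b
     + (move_coef q (lkey g b) (rkey g b) * f b)%:A *: x (gen_act g b))).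
    rewrite scaler_sumr; apply: eq_big_seq => b; rewrite memO => Ob.
    have -> : hecke_gen q g *: ((f b : A)%:A *: x b)
            = (f b : A)%:A *: (hecke_gen q g *: x b).
      by rewrite !scalerA mulr_algl mulr_algr.
    rewrite xg // scalerDr !scalerA.
    by rewrite !mulr_algl !scalerA ![f b * _]mulrC.
  rewrite big_split /= [X in _ + X](perm_big _ pO) /= big_map -big_split.
  apply: eq_bigr => b _; rewrite gen_actK lkey_act rkey_act.
  by rewrite /gen_op !scalerDl.
have psiH k f : k *: psi f = psi (act k f).
  elim/hclassW: k => k; rewrite /act (hecke_actE relT).
  elim: k f => [g|a|k IHk l IHl|k IHk l IHl] f /=.
  - exact: psi_gen.
  - by rewrite hclassC psiZ.
  - by rewrite hclassD scalerDl psiD IHk IHl.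
  - by rewrite hclassM -scalerA IHl IHk.
have psi_base : psi (arr_delta base) = v0.
  rewrite /psi (bigD1_seq base) ?memO ?base_arrangement //= /arr_delta eqxx.
  rewrite scale1r scale1r x0 big1 ?addr0 // => b /negbTE ->.
  by rewrite scale0r scale0r.
have phiK u : psi (phi u) = u.
  by have [k ->] := cyclicM u; rewrite phiH phi0 -psiH psi_base.
(* Going up along the chain, the operator moves the lower sequence with coefficient 1 and has no
   diagonal part there. *)
have phi_vector b v : arr_vector b v -> phi v = arr_delta b.
  elim=> {b v} [//|g b v d _ IH]; rewrite phiH IH /act hecke_act_gen //.
  apply/funext => b'; rewrite /gen_op /arr_delta.
  have -> : (gen_act g b' == gen_act g b) = (b' == b).
    by apply: inj_eq; apply: inv_inj; apply: gen_actK.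
  have [->|_] := eqVneq b' (gen_act g b).
    rewrite lkey_act rkey_act /diag_coef /move_coef.
    have [eb|_] := eqVneq (gen_act g b) b.
      by have := lkey_act theta g b; rewrite eb => e; rewrite e ltxx in d.
    by rewrite lt_eqF // ltNge ltW //= mul0r mulr0 addr0.
  rewrite mulr0 add0r; have [->|_] := eqVneq b' b; last by rewrite mulr0.
  by rewrite /move_coef lt_eqF // ltNge ltW //= mulr1.
have phi_zero : phi 0 = 0.
  by apply: (addrI (phi 0)); rewrite -phiD !addr0.
have phi_coord (a : 'I_(size O) -> A) (j : 'I_(size O)) :
    phi (\sum_i (a i)%:A *: x (nth base O i)) (nth base O j) = a j.
  rewrite (big_morph phi phiD phi_zero) fct_sumE (bigD1 j) //=.
  have phi_x i : phi ((a i)%:A *: x (nth base O i)) (nth base O j)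
      = a i * (nth base O j == nth base O i)%:R.
    rewrite phiH /act hecke_actZ // hecke_act1 // (phi_vector (nth base O i)) //.
    by apply: xP; rewrite -memO mem_nth.
  rewrite phi_x eqxx mulr1 big1 ?addr0 // => i ij.
  by rewrite phi_x nth_uniq // eq_sym (inj_eq val_inj) (negbTE ij) mulr0.
have coord u : u = \sum_(i < size O)
    ((phi u (nth base O i) : A)%:A : hecke q n) *: x (nth base O i).
  by rewrite -[LHS]phiK /psi (big_nth base) big_mkord.
exists (size O), (fun i => x (nth base O i)),
  (\matrix_(i, j) (act h (arr_delta (nth base O j)) (nth base O i))).
split.
- move=> u; exists (\row_i phi u (nth base O i)); split.
    by rewrite [LHS]coord; apply: eq_bigr => i _; rewrite mxE.
  by move=> a ->; apply/rowP => i; rewrite mxE phi_coord.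
- move=> j; rewrite [LHS]coord; apply: eq_bigr => i _; rewrite mxE phiH.
  by rewrite (phi_vector (nth base O j)) //; apply: xP; rewrite -memO mem_nth.
rewrite /mxtrace (big_nth base) big_mkord.
by apply: eq_bigr => i _; rewrite mxE.
Qed.
End CyclicModule.

(** * Coordinates on the induced module *)

Section InducedCharacter.
Variables (A : comNzRingType) (q c : A) (cq : constant_rel q c).
Variables (n : nat) (J : {set gen n}).
Variable chi : {lrmorphism hecke_parabolic q J -> A^o}.
Hypothesis chiE :
  forall s, chi s = hecke_lift (constant_hecke_rel n cq) (\val s).

Local Notation T := {ffun 'I_n.+1 -> int}.
Local Notation theta := (gen_t \in J : nat).
Local Notation gen_op := (gen_op q c theta).
Local Notation delta := (arr_delta A (base J)).
Local Notation M := (induced_rep chi).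
Local Notation iota := (\val : {rmorphism hecke_parabolic q J -> hecke q n}).

Let act : hecke q n -> (T -> A^o) -> (T -> A^o) := hecke_act gen_op.
Let relT := gen_op_rel n theta cq.

Let gen_op_base g : g \in J -> gen_op g delta = c *: delta.
Proof.
move=> gJ; have /eqP e := etrans (base_fixed J g) gJ; apply/funext => b.
rewrite /gen_op /arr_delta fctE; have [->|nb] := eqVneq b (base J).
  by rewrite e /diag_coef /move_coef eqxx mul0r addr0.
have /negbTE -> : gen_act theta g b != base J.
  by apply: contra nb => /eqP e'; rewrite -(gen_actK theta g b) e' gen_act_fix.
by rewrite !mulr0 addr0 [RHS]mulr0.
Qed.

Let act_parabolic s : in_parabolic J s ->
  act s delta = (hecke_lift (constant_hecke_rel n cq) s : A) *: delta.
Proof.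
elim=> {s} [g gJ||a s _ IH|s t _ IHs _ IHt|s t _ IHs _ IHt].
- by rewrite /act hecke_act_gen // gen_op_base // hecke_lift_gen.
- by rewrite /act hecke_act1 // rmorph1 scale1r.
- by rewrite /act hecke_actZ // -/act IH scalerA linearZ.
- by rewrite /act hecke_actD // -/act IHs IHt -scalerDl rmorphD.
- rewrite /act hecke_actM // -/act IHt /act hecke_act_scale // -/act IHs.
  by rewrite scalerA rmorphM mulrC.
Qed.

Fixpoint tterm_coord
    (x : tterm (hecke q n) (char_module chi)) : T -> A^o :=
  match x with
  | TPure h v => (v : A) *: act h delta
  | TZero => 0
  | TOpp y => - tterm_coord y
  | TAdd y z => tterm_coord y + tterm_coord z
  end.

(** Only balancedness involves [chi]: an element of [H_J] acts on [delta] through this character, by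
    [act_parabolic]. *)
Lemma tterm_coord_cong x y :
  tcong iota x y ->
  tterm_coord x = tterm_coord y.
Proof.
elim=> /= {x y}.
- by [].
- by move=> x y _ ->.
- by move=> x y z _ -> _ ->.
- by move=> x x' _ ->.
- by move=> x x' y y' _ -> _ ->.
- by move=> x y z; rewrite addrA.
- by move=> x y; rewrite addrC.
- by move=> x; rewrite add0r.
- by move=> x; rewrite addNr.
- by move=> h k v; rewrite /act hecke_actD // scalerDr.
- by move=> h u v; rewrite -scalerDl.
move=> h s v; rewrite /act hecke_actM // -/act act_parabolic.
  rewrite /act hecke_act_scale // scalerA; congr (_ *: _).
  by rewrite -chiE mulrC.
by have /asboolP := valP s.
Qed.

Definition induced_coord (u : M) : T -> A^o := tterm_coord (repr u).

Lemma induced_coordE x : induced_coord (tclass _ x) = tterm_coord x.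
Proof. exact/tterm_coord_cong/tcong_repr. Qed.

Let one : char_module chi := (1 : A).
Let v0 : M := tensor iota 1 one.

(** The tensor of 1 and 1 is a common eigenvector for [J] and generates the module, so
    [cyclic_character] applies with [induced_coord] as [phi]. *)
Lemma induced_character (O : seq T) (h : hecke q n) : uniq O ->
    (forall b, (b \in O) = arrangement J b) ->
  is_character_value M h (\sum_(b <- O) act h (arr_delta A b) b).
Proof.
move=> uniqO memO.
have tclassD x y : tclass _ (TAdd x y) = tclass _ x + tclass _ y :> M.
  by apply/tclassP; apply: tcong_add; apply/tcong_sym/tcong_repr.
have tclassN x : tclass _ (TOpp x) = - tclass _ x :> M.
  by apply/tclassP; apply: tcong_opp; apply/tcong_sym/tcong_repr.
have val_scalar a : \val (a%:A : hecke_parabolic q J) = a%:A :> hecke q n.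
  by rewrite linearZ rmorph1.
have chi_scalar a : chi a%:A = a :> A.
  by rewrite linearZ rmorph1; apply: mulr1.
apply: (@cyclic_character _ _ _ cq _ J M v0 _ O uniqO memO induced_coord).
- move=> g gJ; rewrite /v0 tensorZ mulr1.
  have gP : hecke_gen q g \in parabolic_pred J.
    exact/asboolP/in_parabolic_gen.
  pose s : hecke_parabolic q J := HeckeParabolic gP.
  have pure (t : hecke_parabolic q J) :
      tensor iota (\val t) one = tensor iota 1 (chi t : char_module chi).
    rewrite -[\val t]mul1r [LHS]tensor_balanced; congr tensor.
    exact: mulr1.
  rewrite -val_scalar.
  rewrite tensorZ mulr1; apply: etrans (pure s) _; apply: etrans (esym (pure _)).
  congr tensor; rewrite chi_scalar chiE.
  exact: hecke_lift_gen.
- move=> u v; elim/tclassW: u => x; elim/tclassW: v => y.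
  by rewrite -tclassD !induced_coordE.
- move=> k u; elim/tclassW: u => x.
  have -> : k *: tclass _ x = tclass _ (tact k x) :> M.
    apply: (@etrans _ _ (tscale k (tclass _ x))) => //.
    by apply/tclassP; apply: tact_cong; apply: tcong_repr.
  rewrite !induced_coordE.
  have act0 : act k 0 = 0.
    by have := hecke_act_scale relT k 0 0; rewrite !scale0r.
  elim: x => [l v||x IHx|x IHx y IHy] //=.
  + by rewrite /act hecke_actM // hecke_act_scale.
  + by rewrite IHx -!scaleN1r /act hecke_act_scale.
  + by rewrite IHx IHy /act hecke_act_add.
- by rewrite [LHS]induced_coordE /= /act hecke_act1 // scale1r.
elim/tclassW => x; elim: x => [k a||x [k IHx]|x [k IHx] y [l IHy]].
(* Viewed as an element of [H_J], the scalar [a] crosses the tensor sign. *)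
- exists ((a : A) *: k). 
  have -> : (a : A) *: k = k * \val ((a : A)%:A : hecke_parabolic q J).
    by rewrite val_scalar mulr_algr.
  rewrite /v0 tensorZ mulr1; apply/esym; apply: etrans (tensor_balanced _ _ _ _) _.
  by congr tensor; apply: etrans (mulr1 _) (chi_scalar _).
- by exists 0; rewrite scale0r.
- by exists (- k); rewrite tclassN IHx scaleNr.
- by exists (k + l); rewrite tclassD IHx IHy scalerDl.
Qed.
End InducedCharacter.

(** * Diagonal entries of words without repetition *)

Section Trace.
Variables (A : comNzRingType) (q c : A) (n theta : nat).
Local Notation T := {ffun 'I_n.+1 -> int}.
Local Notation gen_op := (gen_op q c theta).
Local Notation gen_act := (gen_act theta).
Implicit Types (b : T) (g h : gen n).

Definition letter_sum b : int := \sum_k b k.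
Definition prefix_sum (i : 'I_n) b : int := \sum_(k : 'I_n.+1 | (k <= i)%N) b k.

Lemma letter_sum_s (i : 'I_n) b : letter_sum (gen_act (Some i) b) = letter_sum b.
Proof.
rewrite /letter_sum.
rewrite [RHS](reindex_inj (@perm_inj _ (tperm (left_dot i) (right_dot i)))).
by apply: eq_bigr => k _; rewrite ffunE.
Qed.

Lemma letter_sum_t b : gen_act None b != b ->
  letter_sum (gen_act None b) != letter_sum b.
Proof.
apply: contraNneq; rewrite /letter_sum (bigD1 ord0) //= [RHS](bigD1 ord0) //=.
under eq_bigr => k k0 do rewrite ffunE (negbTE k0).
by move=> /addIr e; rewrite gen_act_fix // /lkey /rkey -[RHS]e ffunE eqxx.
Qed.

Lemma prefix_sum_s (i j : 'I_n) b : i != j ->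
  prefix_sum i (gen_act (Some j) b) = prefix_sum i b.
Proof.
move=> ij; rewrite /prefix_sum.
rewrite [RHS](reindex_inj (@perm_inj _ (tperm (left_dot j) (right_dot j)))).
apply: eq_big => [k|k _]; last by rewrite ffunE.
case: tpermP => // ->; move: ij; rewrite -val_eqE /= /bump; lia.
Qed.

Lemma prefix_sum_move (i : 'I_n) b : gen_act (Some i) b != b ->
  prefix_sum i (gen_act (Some i) b) != prefix_sum i b.
Proof.
apply: contraNneq; rewrite /prefix_sum (bigD1 (left_dot i)) //=.
rewrite [RHS](bigD1 (left_dot i)) //=.
under eq_bigr => k /andP[ki kl].
  rewrite ffunE tpermD 1?eq_sym //; first over.
  by rewrite -val_eqE /= /bump; lia.
by move=> /addIr e; rewrite gen_act_fix // /lkey /rkey -[LHS]e ffunE tpermL.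
Qed.

(** Used with the letter sum for [I]: a word without [t] keeps the support inside one level set. *)
Lemma foldr_gen_op_support (I : T -> int) (r : seq (gen n)) z (f : T -> A^o) :
  (forall g b, g \in r -> I (gen_act g b) = I b) ->
  (forall b, I b != z -> f b = 0) ->
  forall b, I b != z -> foldr gen_op f r b = 0.
Proof.
elim: r => [|g r IHr] //= Ir fz b bz.
have f0 b' : I b' != z -> foldr gen_op f r b' = 0.
  by apply: IHr => // h b2 hr; apply: Ir; rewrite inE hr orbT.
by rewrite {1}/gen_op !f0 ?mulr0 ?addr0 // Ir ?mem_head.
Qed.

(* Returning to b with t applied at most once is impossible after a genuine
   sign change, and without one only s_i changes the sum of the first i letters. *)
Lemma foldr_gen_op_off (r : seq (gen n)) (i : 'I_n) b b' :
  uniq r -> Some i \notin r ->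
  letter_sum b' = letter_sum b -> prefix_sum i b' != prefix_sum i b ->
  foldr gen_op (arr_delta A b) r b' = 0.
Proof.
elim: r b' => [|g r IHr] b' /=.
  move=> _ _ _; apply: contraNeq; rewrite /arr_delta.
  by have [->|_] := eqVneq _ b; rewrite ?eqxx.
move=> /andP[gr ur]; rewrite inE negb_or => /andP[ig ir] e ne.
rewrite {1}/gen_op IHr // mulr0 add0r.
case: g gr ig => [j|] gr ig.
  rewrite (IHr (gen_act _ _)) ?mulr0 ?letter_sum_s //.
  by rewrite prefix_sum_s //; apply: contraNneq ig => ->.
rewrite /move_coef; case: ifP => [_|/negbT d]; first by rewrite mul0r.
rewrite (foldr_gen_op_support (I := letter_sum) (z := letter_sum b)) ?mulr0 //.
- by case=> [j b2 _|b2 h0]; [apply: letter_sum_s|rewrite h0 in gr].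
- move=> b2; apply: contraNeq; rewrite /arr_delta.
  by have [->|_] := eqVneq _ b; rewrite ?eqxx.
rewrite -e; apply: letter_sum_t; apply: contraNneq d => eb.
by rewrite -{1}eb rkey_act.
Qed.

(** In the moving term of the first letter [g], the rest of the word would have to undo a genuine
    move without using [g]; the prefix sum forbids this for a swap, the letter sum for [t]. *)
Lemma foldr_gen_op_diag (r : seq (gen n)) b : uniq r ->
  foldr gen_op (arr_delta A b) r b
  = \prod_(g <- r) diag_coef q c (lkey theta g b) (rkey g b).
Proof.
elim: r => [|g r IHr] /=; first by rewrite big_nil /arr_delta eqxx.
move=> /andP[gr ur]; rewrite big_cons -IHr // {1}/gen_op.
suff -> : move_coef q (rkey g b) (lkey theta g b)
          * foldr gen_op (arr_delta A b) r (gen_act g b) = 0 by rewrite addr0.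
rewrite /move_coef; case: ifP => [_|/negbT d]; first by rewrite mul0r.
have gb : gen_act g b != b.
  by apply: contraNneq d => eb; rewrite -{1}eb rkey_act.
case: g gr d gb => [i|] gr d gb.
  by rewrite (@foldr_gen_op_off _ i) ?mulr0 ?letter_sum_s ?prefix_sum_move.
rewrite (foldr_gen_op_support (I := letter_sum) (z := letter_sum b)) ?mulr0 //.
- by case=> [i b2 _|b2 h0]; [apply: letter_sum_s|rewrite h0 in gr].
- move=> b2; apply: contraNeq; rewrite /arr_delta.
  by have [->|_] := eqVneq _ b; rewrite ?eqxx.
exact: letter_sum_t.
Qed.
End Trace.

(** * Reduced words of parabolic elements *)

Section ReducedWord.
Variable n : nat.
Implicit Types (g h : gen n) (x : spoint n) (r : seq (gen n)).

(** Preserved by all generators except [g], hence a witness that [g] occurs in a word. *)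
Definition stable_set g : {pred spoint n} :=
  fun x => if g is Some i then (x.1 <= i)%N else ~~ x.2.

Lemma gen_perm_stable g h x : g != h ->
  (gen_perm h x \in stable_set g) = (x \in stable_set g).
Proof.
rewrite !unfold_in; case: h g => [j|] [i|] //= gh; last first.
- by case: tpermP => [->|->|].
- have sign k l s y : (tperm (k, s) (l, s) y).2 = y.2 :> bool.
    by case: tpermP => [->|->|].
  by rewrite permM !sign.
have ij : i <> j :> nat by move=> /val_inj e; rewrite e eqxx in gh.
have dot s y : ((tperm (left_dot j, s) (right_dot j, s) y).1 <= i)%N = (y.1 <= i)%N.
  by case: tpermP => [->|->|//]; rewrite /= /bump; lia.
by rewrite permM !dot.
Qed.

Lemma word_perm_stable g r x : g \notin r ->
  (word_perm r x \in stable_set g) = (x \in stable_set g).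
Proof.
rewrite /word_perm; elim: r x => [|h r IHr] x; first by rewrite big_nil perm1.
rewrite inE negb_or => /andP[gh gr]; rewrite big_cons permM IHr //.
exact: gen_perm_stable.
Qed.

Lemma gen_perm_unstable g :
  exists2 x, x \in stable_set g & gen_perm g x \notin stable_set g.
Proof.
case: g => [i|]; last by exists (ord0, false); rewrite ?unfold_in //= tpermL.
exists (left_dot i, false); first by rewrite unfold_in /=.
rewrite unfold_in /= permM tpermL tpermD ?xpair_eqE ?andbF //= /bump; lia.
Qed.

(** If [r] missed some [g] in [K], then [w] would preserve the stable set of [g], although [g]
    occurs exactly once in [r0]. So [r] contains [K], and minimal length forbids repetitions. *)
Lemma reduced_parabolic_perm (K : {set gen n}) w r :
  parabolic_element K w -> reduced_expression r w -> perm_eq r (enum K).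
Proof.
move=> [_ [r0 [r0K w0]]] [rw rmin].
have Kr : {subset enum K <= r}.
  move=> g gK; apply/negPn/negP => gr.
  have [x xS gxS] := gen_perm_unstable g.
  have ur0 : uniq r0 by rewrite (perm_uniq r0K) enum_uniq.
  have gr0 : g \in r0 by rewrite (perm_mem r0K).
  case/splitPr: gr0 ur0 w0 => u v; rewrite cat_uniq /= => /and3P[_ guv /andP[gv _]].
  have gu : g \notin u by move: guv; rewrite negb_or => /andP[].
  rewrite /word_perm big_cat big_cons /= -!/(word_perm _) => w0.
  (* Products apply their left factor first, so the test point is pulled back through [u]. *)
  move: (word_perm_stable ((word_perm u)^-1%g x) gr).
  rewrite rw w0 !permM permKV word_perm_stable // (negbTE gxS).
  by rewrite -(word_perm_stable _ gu) permKV xS.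
have sr : (size r <= size (enum K))%N.
  by rewrite -(perm_size r0K); apply: rmin.
have [_ e] := uniq_min_size (enum_uniq _) Kr sr.
rewrite perm_sym; apply: uniq_perm => //; first exact: enum_uniq.
exact: leq_size_uniq (enum_uniq _) Kr sr.
Qed.
End ReducedWord.

(** * Block sizes and signed compositions *)

(** The interval is split at its first bar [m]: before it no bar has been passed, and from it on one
    more than among the remaining bars. *)
Lemma nth_pairmap_sub (s : seq nat) x N k : path leq x (rcons s N) ->
  nth 0%N (pairmap (fun x y => y - x)%N x (rcons s N)) k
  = count (fun l => count (leq^~ l) s == k) (iota x (N - x)).
Proof.
elim: s x k => [|m s IHs] x k /=.
  by move=> _; case: k => [|k] /=; rewrite ?nth_nil ?count_predT ?count_pred0 ?size_iota.
move=> /andP[xm ms].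
have mN : (m <= N)%N.
  by move/allP: (order_path_min leq_trans ms); apply; rewrite mem_rcons mem_head.
have sm l : (l < m)%N -> count (leq^~ l) s = 0%N.
  move=> lm; apply/eqP; rewrite -leqn0 leqNgt -has_count; apply/hasPn => y ys.
  rewrite -ltnNge; apply: leq_trans lm _.
  by move/allP: (order_path_min leq_trans ms); apply; rewrite mem_rcons inE ys orbT.
have -> : (N - x = (m - x) + (N - m))%N by lia.
rewrite iotaD count_cat subnKC //.
rewrite (eq_in_count (a2 := fun=> k == 0%N)) => [|l]; last first.
  rewrite mem_iota subnKC // => /andP[_ lm].
  by rewrite leqNgt lm sm // eq_sym.
rewrite [X in (_ + X)%N](eq_in_count (a2 := fun l => (count (leq^~ l) s).+1 == k)) => [|l]; last first.
  by rewrite mem_iota => /andP[-> _].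
case: k => [|k] /=.
  by rewrite count_predT size_iota [X in (_ + X)%N]count_pred0 addn0.
by rewrite count_pred0 add0n IHs.
Qed.

Section Composition.
Variables (n : nat) (J : {set gen n}).
Local Notation T := {ffun 'I_n.+1 -> int}.
Local Notation lam := (signed_composition J).
Implicit Types (a : 'I_n.+1 -> int) (b : T) (K : {set gen n}).

Lemma path_bars : path leq 0 (rcons (bars J) n.+1).
Proof.
rewrite /bars rcons_path; apply/andP; split.
  apply: (@sub_path _ ltn) => [x y|]; first exact: ltnW.
  rewrite path_min_sorted; last by apply/allP => x /mapP[i _ ->].
  rewrite sorted_map; apply: sorted_filter; first by move=> x y z; apply: ltn_trans.
  by have := iota_ltn_sorted 0 n; rewrite -val_enum_ord sorted_map.
have := mem_last 0%N (bars J); rewrite inE => /predU1P[->//|].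
by case/mapP => i _ ->; rewrite ltnS ltnW.
Qed.

Lemma size_signed_composition : size lam = (size (bars J)).+1.
Proof.
rewrite /signed_composition /block_sizes.
rewrite -(size_rcons (bars J) n.+1) -(size_pairmap (fun x y => y - x)%N 0%N).
by case: pairmap => //= m s; rewrite size_map.
Qed.

Lemma signed_composition_abs (k : nat) :
  `|lam`_k| = #|[set l : 'I_n.+1 | block J l == k]|%:Z.
Proof.
have -> : `|lam`_k| = (nth 0%N (block_sizes J) k)%:Z.
  rewrite /signed_composition; case: (block_sizes J) => [|m s]; first by rewrite !nth_nil.
  case: k => [|k] /=; first by case: ifP; rewrite ?normrN.
  have [ks|ks] := ltnP k (size s); first by rewrite (nth_map 0%N).
  (* Past the last part both lists return the default 0. *)
  by rewrite !nth_default ?size_map ?normr0.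
rewrite /block_sizes (nth_pairmap_sub _ path_bars) subn0; congr Posz.
by rewrite cardsE cardE size_filter -enumT -val_enum_ord count_map.
Qed.

Lemma block_bound k : (block J k < size lam)%N.
Proof. by rewrite size_signed_composition ltnS count_size. Qed.

Lemma count_abs (f : 'I_n.+1 -> int) v :
  count_mem v [seq `|f k|%N | k : 'I_n.+1] = #|[set k | `|f k| == v%:Z]|.
Proof.
rewrite cardsE cardE size_filter -enumT /= /image_mem count_map.
by apply: eq_count => k /=; lia.
Qed.

Lemma count_base v :
  count_mem v [seq `|base J k|%N | k : 'I_n.+1]
  = if v is v'.+1 then #|[set l : 'I_n.+1 | block J l == v']| else 0%N.
Proof.
rewrite count_abs; case: v => [|v].
  by apply: eq_card0 => k; rewrite inE ffunE.
by apply: eq_card => k; rewrite !inE ffunE.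
Qed.

(** Prescribing how often each absolute value occurs determines the multiset of absolute values,
    because 0 and values above the number of parts occur in neither sequence. *)
Lemma admissible0 a : admissible J set0 lam a = arrangement J [ffun k => a k].
Proof.
rewrite /admissible !inE /=.
have -> : [forall i : 'I_n, (gen_s i \in set0) ==> (a (right_dot i) <= a (left_dot i))].
  by apply/forallP => i; rewrite inE.
rewrite /= andbT /arrangement.
have -> : [forall k, [ffun k => a k] k != -1] = [forall i, a i != -1].
  by apply: eq_forallb => i; rewrite ffunE.
have -> : [seq `|[ffun k => a k] k|%N | k : 'I_n.+1] = [seq `|a k|%N | k : 'I_n.+1].
  by apply: eq_map => k; rewrite ffunE.
rewrite andbA; congr (_ && _); apply/andP/idP => [[/forallP a1 /forallP a2]|/seq.permP ap].
  apply/allP => v _ /=; apply/eqP.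
  rewrite count_base count_abs; case: v => [|v].
    by apply: eq_card0 => k; rewrite !inE; have := a1 k; case: eqP => //; lia.
  have [vl|vl] := ltnP v (size lam).
    by have /eqP := a2 (Ordinal vl); rewrite signed_composition_abs => -[].
  rewrite !eq_card0 // => k; rewrite !inE.
    by have := block_bound k; lia.
  by have := a1 k; lia.
split; apply/forallP => k; last first.
  by rewrite signed_composition_abs -count_abs ap count_base.
have : `|a k|%N \in [seq `|base J k|%N | k : 'I_n.+1].
  rewrite -has_pred1 has_count -ap -has_count has_pred1; exact: image_f.
by move=> /imageP[l _]; rewrite ffunE; have := block_bound l; lia.
Qed.

Lemma admissibleE K a : admissible J K lam a =
  [&& admissible J set0 lam a,
      [forall i : 'I_n, (gen_s i \in K) ==> (a (right_dot i) <= a (left_dot i))] &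
      (gen_t \in K) ==> ((a ord0 < 0) || (a ord0 == 1) && (gen_t \in J))].
Proof.
rewrite /admissible [gen_t \in set0]inE /= andbT.
have -> : [forall i : 'I_n, (gen_s i \in set0) ==> (a (right_dot i) <= a (left_dot i))].
  by apply/forallP => i; rewrite inE.
by rewrite andbT -!andbA.
Qed.

End Composition.

(** * The character formula *)

Lemma prod_option (A : comNzRingType) (I : finType) (P : pred (option I))
    (F : option I -> A) :
  \prod_(x | P x) F x
  = (if P None then F None else 1) * \prod_(i | P (Some i)) F (Some i).
Proof.
rewrite big_mkcond (bigD1 None) //= [in RHS]big_mkcond; congr (_ * _).
rewrite (reindex_omap Some id) => [|[]//].
by apply: eq_bigl => i /=; rewrite eqxx.
Qed.

Section CharacterFormula.
Variables (A : comNzRingType) (q c : A) (n : nat) (J K : {set gen n}).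
Local Notation T := {ffun 'I_n.+1 -> int}.
Local Notation theta := (gen_t \in J : nat).
Local Notation lam := (signed_composition J).
Local Notation p := (size lam).
Implicit Types (b : T) (g : gen n).

(** Finite functions, unlike the members of [int_seqs], have decidable equality, as [uniq] and
    membership require. *)
Definition arrangements : seq T :=
  [seq b <- [seq [ffun k => int_of_ord (a k)] | a : {ffun 'I_n.+1 -> 'I_p.*2.+1}]
     | arrangement J b].

Lemma uniq_arrangements : uniq arrangements.
Proof.
rewrite filter_uniq // map_inj_uniq ?enum_uniq // => a a' /ffunP e; apply/ffunP => k.
by apply: val_inj; have := e k; rewrite !ffunE /int_of_ord /=; lia.
Qed.

Lemma mem_arrangements b : (b \in arrangements) = arrangement J b.
Proof.
rewrite mem_filter; case Ob: (arrangement J b) => //=.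
have bp k : `|b k| <= p%:Z.
  by have [l] := arrangement_abs k Ob; have := block_bound J l; lia.
apply/imageP; exists [ffun k => inord `|(b k + p%:Z)%R|%N] => //.
apply/ffunP => k; have bk := bp k; rewrite !ffunE /int_of_ord inordK; last by lia.
by rewrite gez0_abs ?addrK //; lia.
Qed.

Lemma sum_arrangements (F : ('I_n.+1 -> int) -> A) :
  (forall a a', a =1 a' -> F a = F a') ->
  \sum_(a <- int_seqs n.+1 p | admissible J set0 lam a) F a
  = \sum_(b <- arrangements) F b.
Proof.
move=> extF; rewrite /int_seqs /arrangements big_filter !big_map.
apply: eq_big => [a|a _]; first by rewrite admissible0.
by apply: extF => k; rewrite ffunE.
Qed.

Let card_sum (I : finType) (P : pred I) : #|[set i | P i]| = (\sum_i P i)%N.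
Proof. by rewrite cardsE -sum1_card big_mkcond. Qed.

(** A generator in [K] contributes [q - 1] at a descent, [c] where it fixes [b], and 0 at an ascent;
    the zeros impose the conditions that involve [K]. *)
Lemma prod_diag_coef b : arrangement J b ->
  \prod_(g in K) diag_coef q c (lkey theta g b) (rkey g b)
  = if admissible J K lam b
    then c ^+ (stat_e K b + stat_g K b) * (q - 1) ^+ (stat_d K b + stat_f K b)
    else 0.
Proof.
move=> Ob; rewrite prod_option admissibleE admissible0.
have -> : [ffun k => b k] = b by apply/ffunP => k; rewrite ffunE.
rewrite Ob /=.
have -> : (if None \in K then diag_coef q c (lkey theta None b) (rkey None b) else 1)
  = if (gen_t \in K) ==> ((b ord0 < 0) || (b ord0 == 1) && (gen_t \in J))
    then c ^+ stat_g K b * (q - 1) ^+ stat_f K b else 0.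
  rewrite /stat_g /stat_f -/(@gen_t n); case: (gen_t \in K) => /=; last by rewrite mul1r.
  have nz := arrangement_neq0 ord0 Ob; have fx := arrangement_fixed ord0 Ob.
  rewrite /diag_coef /lkey /rkey flip_fixed flip_gt fx.
  case: (ltgtP (b ord0) 0) nz => // sb _.
    have b1 : (b ord0 == 1) = false by lia.
    rewrite b1 /= in fx *; have -> : b ord0 < - theta%:Z.
      by case: (gen_t \in J) fx => /= fx; lia.
    by rewrite mul1r.
  have -> : (b ord0 < - theta%:Z) = false by case: (gen_t \in J); lia.
  by case: ifP => //=; rewrite mulr1.
have -> : \prod_(i | Some i \in K) diag_coef q c (lkey theta (Some i) b) (rkey (Some i) b)
  = if [forall i : 'I_n, (gen_s i \in K) ==> (b (right_dot i) <= b (left_dot i))]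
    then c ^+ stat_e K b * (q - 1) ^+ stat_d K b else 0.
  case: ifP => [/forallP le_b|/negbT]; last first.
    rewrite negb_forall; case/existsP => i; rewrite negb_imply -ltNge => /andP[iK d].
    rewrite (bigD1 i) //= /diag_coef /lkey /rkey lt_eqF // ltNge ltW //=.
    by rewrite mul0r.
  rewrite /stat_e /stat_d !card_sum !expr_sum -big_split /= big_mkcond.
  apply: eq_bigr => i _; rewrite -/(gen_s i); have := le_b i.
  case: (gen_s i \in K) => /= [|_]; last by rewrite mulr1.
  by rewrite /diag_coef /lkey /rkey; case: ltgtP => // _ _; rewrite ?mulr1 ?mul1r.
case: [forall i, _]; last by rewrite mulr0.
case: (_ ==> _); last by rewrite mul0r.
by rewrite /= !exprD mulrACA; congr (_ * _); apply: mulrC.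
Qed.

Hypothesis cq : constant_rel q c.
Variable chi : {lrmorphism hecke_parabolic q J -> A^o}.
Hypothesis chiE :
  forall s, chi s = hecke_lift (constant_hecke_rel n cq) (\val s).

(** Keeping [c] general lets the trivial and sign cases share one proof. *)
Lemma induced_character_parabolic (w : {perm spoint n}) (r : seq (gen n)) :
  parabolic_element K w -> reduced_expression r w ->
  is_character_value (induced_rep chi) (hecke_word q r)
    (\sum_(a <- int_seqs n.+1 p | admissible J K lam a)
        c ^+ (stat_e K a + stat_g K a) * (q - 1) ^+ (stat_d K a + stat_f K a)).
Proof.
move=> wK rw; have rK := reduced_parabolic_perm wK rw.
have ur : uniq r by rewrite (perm_uniq rK) enum_uniq.
set S := (X in is_character_value _ _ X).
suff -> : S = \sum_(b <- arrangements)
    hecke_act (gen_op q c theta) (hecke_word q r) (arr_delta A b) b.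
  exact: (induced_character chiE _ uniq_arrangements mem_arrangements).
(* The conditions involving [K] pass from the index set to the summand, to match the vanishing
   diagonal entries. *)
transitivity (\sum_(a <- int_seqs n.+1 p | admissible J set0 lam a)
    if admissible J K lam a then
      c ^+ (stat_e K a + stat_g K a) * (q - 1) ^+ (stat_d K a + stat_f K a)
    else 0).
  rewrite -big_mkcondr; apply: eq_bigl => a.
  by rewrite [admissible J K lam a]admissibleE; case: (admissible J set0 lam a).
rewrite sum_arrangements; last first.
  by move=> a a' /funext ->.
apply: eq_big_seq => b; rewrite mem_arrangements => Ob.
rewrite -prod_diag_coef //.
have -> f : hecke_act (gen_op q c theta) (hecke_word q r) f
            = foldr (gen_op q c theta) f r.
  elim: (r) f => [|g s IHs] f.
    by rewrite /hecke_word big_nil hecke_act1 //; apply: gen_op_rel.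
  have relT := gen_op_rel n theta cq.
  by rewrite hecke_word_cons hecke_actM // IHs hecke_act_gen.
by rewrite foldr_gen_op_diag // (perm_big _ rK) big_enum.
Qed.
End CharacterFormula.

Theorem theorem2p5 (R : realType) (n : nat) (J K : {set gen n})
    (w : {perm spoint n}) (r : seq (gen n)) :
  parabolic_element K w ->
  reduced_expression r w ->
  let q : laurent R[i] := laurent_var R[i] ^+ 2 in
  let lam := signed_composition J in
  let p := size lam in
  is_character_value (induced_rep (trivial_rep q J)) (hecke_word q r)
    (\sum_(a <- int_seqs n.+1 p | admissible J K lam a)
        q ^+ (stat_e K a + stat_g K a) * (q - 1) ^+ (stat_d K a + stat_f K a))
  /\
  is_character_value (induced_rep (sign_rep q J)) (hecke_word q r)
    (\sum_(a <- int_seqs n.+1 p | admissible J K lam a)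
        (-1) ^+ (stat_e K a + stat_g K a)
        * (q - 1) ^+ (stat_d K a + stat_f K a)).

Proof.
move=> wK rw q lam p; split.
  (* [trivial_rep] is by definition a restriction of [hecke_lift], so [chiE] is reflexivity;
     likewise for [sign_rep]. *)
  exact: (@induced_character_parabolic _ q q n J K (constant_rel_q q)
            (trivial_rep q J) (fun=> erefl) w r).
exact: (@induced_character_parabolic _ q (-1) n J K (constant_rel_N1 q)
          (sign_rep q J) (fun=> erefl) w r).
Qed.
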